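(* Let $(M,J,g)$ be an anti-Kähler manifold with $\dim M\ge4$, let $c$ be a symmetric $(0,2)$-tensor field on $M$, and let $\overline g={}^{II}g+{}^0c$ be the deformed 2-nd lift metric on the second-order tangent bundle $T^2M$. Then $(T^2M,{}^{II}J,\overline g)$ is an anti-Kähler manifold if and only if $c$ is a holomorphic tensor field with respect to the almost complex structure $J$.
   Context: All objects are of class $C^\infty$; repeated indices are summed. The second-order tangent bundle $T^2M$ of an $n$-dimensional manifold $M$ is the $3n$-dimensional manifold of all 2-jets at $0$ of maps $\mathbb R\to M$. A chart $(U,x^i)$ of $M$ induces coordinates $(x^i,y^i,z^i)$ on the preimage of $U$ in $T^2M$: for the 2-jet of a curve $F$, locally $x^i=F^i(t)$, one puts $x^i=F^i(0)$, $y^i=\frac{dF^i}{dt}(0)$, $z^i=\frac12\frac{d^2F^i}{dt^2}(0)$. The deformed 2-nd lift metric is the pseudo-Riemannian metric on $T^2M$ whose matrix in induced coordinates, ordered as $(x,y,z)$, is $$\overline g={}^{II}g+{}^0c=\begin{pmatrix} z^s\partial_s g_{ij}+\frac12 y^ty^s\partial_t\partial_s g_{ij}+c_{ij} & y^s\partial_s g_{ij} & g_{ij}\\ y^s\partial_s g_{ij}& g_{ij}&0\\ g_{ij}&0&0\end{pmatrix},\qquad \partial_i=\frac{\partial}{\partial x^i}.$$ Lifts of a vector field $X=X^i\partial_i$ on $M$ to $T^2M$: ${}^0X=X^j\frac{\partial}{\partial z^j}$; ${}^IX=X^j\frac{\partial}{\partial y^j}+y^s\partial_sX^j\frac{\partial}{\partial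 z^j}$; ${}^{II}X=X^j\frac{\partial}{\partial x^j}+y^s\partial_sX^j\frac{\partial}{\partial y^j}+\{z^s\partial_sX^j+\frac12y^ty^s\partial_t\partial_sX^j\}\frac{\partial}{\partial z^j}$. The 2-nd lift ${}^{II}J$ of a $(1,1)$-tensor field $J$ on $M$ is the $(1,1)$-tensor field on $T^2M$ determined by ${}^{II}J({}^{II}X)={}^{II}(JX)$, ${}^{II}J({}^IX)={}^I(JX)$, ${}^{II}J({}^0X)={}^0(JX)$ for all vector fields $X$ on $M$. If $J$ is an almost complex structure on $M$, then ${}^{II}J$ is an almost complex structure on $T^2M$. An anti-Hermitian metric on a manifold with almost complex structure $J$ is a pseudo-Riemannian metric $g$ with $g(JX,Y)=g(X,JY)$ for all vector fields $X,Y$. An anti-Kähler manifold is a triple $(M,J,g)$ with $J$ an almost complex structure and $g$ an anti-Hermitian metric such that $\nabla J=0$, where $\nabla$ is the Levi-Civita connection of $g$. A symmetric $(0,2)$-tensor field $c$ is holomorphic with respect to $J$ if it is pure, i.e. $c(JX,Y)=c(X,JY)$ for all $X,Y$, and $\Phi_Jc=0$, where $\Phi_J$ is the Tachibana operator $$(\Phi_Jc)(X,Y,Z)=(JX)(c(Y,Z))-X(c(JY,Z))+c((L_YJ)X,Z)+c(Y,(L_ZJ)X),$$ $L$ denoting Lie derivative. *)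

(* Defs.v *)
From HB Require Import structures.
From mathcomp Require Import all_boot all_order all_algebra.
From mathcomp Require Import boolp classical_sets functions cardinality reals.
From mathcomp Require Import topology normedtype derive.

Set Implicit Arguments.
Unset Strict Implicit.
Unset Printing Implicit Defensive.

Import Order.TTheory GRing.Theory Num.Theory.
Import numFieldNormedType.Exports.

Local Open Scope classical_set_scope.
Local Open Scope ring_scope.

(* C^oo on an open set A: f and all its iterated directional derivatives are
   differentiable at every point of A.  Since A is open, only the values of f
   on A matter. *)
Definition smooth_on (R : realType) (V W : normedModType R) (A : set V)
    (f : V -> W) : Prop :=
  forall (s : seq V) (x : V), A x ->
    differentiable (foldr (fun v h => 'D_v h) f s) x.

Definition partial (R : realType) (n : nat) (W : normedModType R) (s : 'I_n)
    (f : 'rV[R]_n -> W) : 'rV[R]_n -> W :=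
  'D_(delta_mx 0 s) f.

(* v^s \partial_s f *)
Definition lift1 (R : realType) (n : nat) (W : normedModType R)
    (f : 'rV[R]_n -> W) (x v : 'rV[R]_n) : W :=
  \sum_s v 0 s *: partial s f x.

(* z^s \partial_s f + 1/2 y^t y^s \partial_t \partial_s f *)
Definition lift2 (R : realType) (n : nat) (W : normedModType R)
    (f : 'rV[R]_n -> W) (x y z : 'rV[R]_n) : W :=
  \sum_s z 0 s *: partial s f x +
  2^-1 *: \sum_t \sum_s (y 0 t * y 0 s) *: partial t (partial s f) x.

(* A set with R^n-valued charts; the topology is not part of the data, it is
   the one generated by the charts (see mopen). *)
Record charted (R : realType) (n : nat) : Type := Charted {
  carrier :> Type ;
  idx : Type ;
  chart_dom : idx -> set carrier ;
  chart_map : idx -> carrier -> 'rV[R]_n }.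

Section Manifold.
Context {R : realType} {n : nat} (M : charted R n).

Definition chart_image (i : idx M) : set 'rV[R]_n := chart_map i @` chart_dom i.

Definition overlap (i j : idx M) : set 'rV[R]_n :=
  chart_map i @` (chart_dom i `&` chart_dom j).

(* The change of coordinates from chart i to chart j on overlap i j, and 0
   elsewhere. *)
Definition transition (i j : idx M) (x : 'rV[R]_n) : 'rV[R]_n :=
  xget 0 [set y | exists p : M,
    [/\ chart_dom i p, chart_dom j p, chart_map i p = x & chart_map j p = y]].

Definition mopen (A : set M) : Prop :=
  forall i : idx M, open (chart_map i @` (A `&` chart_dom i)).

Definition is_manifold : Prop :=
  [/\ (forall i (p q : M), chart_dom i p -> chart_dom i q ->
         chart_map i p = chart_map i q -> p = q),
      (forall i j : idx M, open (overlap i j)),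
      (forall i j : idx M, smooth_on (overlap i j) (transition i j)),
      (exists2 D : set (idx M), countable D &
         forall p : M, exists2 i, D i & chart_dom i p) &
      (forall p q : M, p <> q ->
         exists A B : set M,
           [/\ mopen A, mopen B, A p, B q & A `&` B = set0])].

Definition smooth_curve (F : R -> M) : Prop :=
  forall i : idx M, open (F @^-1` chart_dom i) /\
    smooth_on (F @^-1` chart_dom i) (fun t : R => chart_map i (F t)).

(* Tensor fields are given by their components in every chart, as functions of
   the coordinates; the components outside the image of the chart are
   irrelevant.  Tangent vectors are row vectors: X = X 0 a \partial_a,
   J (\partial_a) = J a b \partial_b (so that J X has components X *m J), and
   c (\partial_a, \partial_b) = c a b.  With the library's convention,
   ('J f x) a b = \partial_a f^b. *)
Definition vcomp : Type := idx M -> 'rV[R]_n -> 'rV[R]_n.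
Definition mcomp : Type := idx M -> 'rV[R]_n -> 'M[R]_n.

Definition vector_field (X : vcomp) : Prop :=
  (forall i, smooth_on (chart_image i) (X i)) /\
  (forall i j x, overlap i j x ->
     X j (transition i j x) = X i x *m 'J (transition i j) x).

Definition tensor11 (J : mcomp) : Prop :=
  (forall i, smooth_on (chart_image i) (J i)) /\
  (forall i j x, overlap i j x ->
     'J (transition i j) x *m J j (transition i j x) =
     J i x *m 'J (transition i j) x).

Definition tensor02 (c : mcomp) : Prop :=
  (forall i, smooth_on (chart_image i) (c i)) /\
  (forall i j x, overlap i j x ->
     c i x = 'J (transition i j) x *m c j (transition i j x)
             *m ('J (transition i j) x)^T).

Definition symmetric_tensor02 (c : mcomp) : Prop :=
  tensor02 c /\ (forall i x, chart_image i x -> (c i x)^T = c i x).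

Definition almost_complex (J : mcomp) : Prop :=
  tensor11 J /\
  (forall i x, chart_image i x -> J i x *m J i x = - 1%:M).

Definition pseudo_riemannian (g : mcomp) : Prop :=
  symmetric_tensor02 g /\
  (forall i x, chart_image i x -> g i x \in unitmx).

Definition app (J : mcomp) (X : vcomp) : vcomp := fun i x => X i x *m J i x.

Definition eval (c : mcomp) (X Y : vcomp) (i : idx M) (x : 'rV[R]_n) : R :=
  (X i x *m c i x *m (Y i x)^T) 0 0.

Definition pure (J c : mcomp) : Prop :=
  forall X Y : vcomp, vector_field X -> vector_field Y ->
  forall i x, chart_image i x ->
    eval c (app J X) Y i x = eval c X (app J Y) i x.

Definition anti_hermitian (J g : mcomp) : Prop :=
  pseudo_riemannian g /\ pure J g.

(* Gamma^m_{ab} of the Levi-Civita connection of g in the chart i *)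
Definition christoffel (g : mcomp) (i : idx M) (a b m : 'I_n)
    (x : 'rV[R]_n) : R :=
  2^-1 * \sum_l invmx (g i x) m l *
    (partial a (fun u => g i u l b) x + partial b (fun u => g i u l a) x
     - partial l (fun u => g i u a b) x).

(* (\nabla_k J)_a^b *)
Definition nabla11 (g J : mcomp) (i : idx M) (k a b : 'I_n)
    (x : 'rV[R]_n) : R :=
  partial k (fun u => J i u a b) x
  + \sum_s christoffel g i k s b x * J i x a s
  - \sum_s christoffel g i k a s x * J i x s b.

Definition anti_kahler (J g : mcomp) : Prop :=
  [/\ is_manifold, almost_complex J, anti_hermitian J g &
      forall i k a b x, chart_image i x -> nabla11 g J i k a b x = 0].

Definition bracket (X Y : vcomp) : vcomp :=
  fun i x => lift1 (Y i) x (X i x) - lift1 (X i) x (Y i x).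

(* (L_Y J) X = [Y, J X] - J [Y, X] *)
Definition lie11 (Y : vcomp) (J : mcomp) (X : vcomp) : vcomp :=
  fun i x => bracket Y (app J X) i x - app J (bracket Y X) i x.

Definition tachibana (J c : mcomp) (X Y Z : vcomp) (i : idx M)
    (x : 'rV[R]_n) : R :=
  lift1 (eval c Y Z i) x (app J X i x)
  - lift1 (eval c (app J Y) Z i) x (X i x)
  + eval c (lie11 Y J X) Z i x
  + eval c Y (lie11 Z J X) i x.

Definition holomorphic (J c : mcomp) : Prop :=
  pure J c /\
  (forall X Y Z : vcomp, vector_field X -> vector_field Y -> vector_field Z ->
   forall i x, chart_image i x -> tachibana J c X Y Z i x = 0).

Definition jet_coord (i : idx M) (F : R -> M) : 'rV[R]_(n + n + n) :=
  let f := fun t : R => chart_map i (F t) in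
  row_mx (row_mx (f 0) (f^`()%classic 0)) (2^-1 *: f^`(2)%classic 0).

Definition same_jet (F G : R -> M) : Prop :=
  F 0 = G 0 /\ forall i, chart_dom i (F 0) -> jet_coord i F = jet_coord i G.

Definition jet_class (F : R -> M) : set (R -> M) :=
  [set G | smooth_curve G /\ same_jet F G].

(* 2-jets at 0, as equivalence classes of smooth curves *)
Definition jet2 : Type :=
  {P : set (R -> M) | exists F, smooth_curve F /\ P = jet_class F}.

Definition jet_repr (P : jet2) : R -> M := projT1 (cid (svalP P)).

Definition T2 : charted R (n + n + n) := {|
  carrier := jet2 ;
  idx := idx M ;
  chart_dom := fun i => [set P | chart_dom i (jet_repr P 0)] ;
  chart_map := fun i P => jet_coord i (jet_repr P) |}.

End Manifold.

Section Lifts.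
Context {R : realType} {n : nat} (M : charted R n).

Definition xpart (w : 'rV[R]_(n + n + n)) : 'rV[R]_n := lsubmx (lsubmx w).
Definition ypart (w : 'rV[R]_(n + n + n)) : 'rV[R]_n := rsubmx (lsubmx w).
Definition zpart (w : 'rV[R]_(n + n + n)) : 'rV[R]_n := rsubmx w.

Definition lift0_vf (X : vcomp M) : vcomp (T2 M) := fun i w =>
  row_mx (row_mx 0 0) (X i (xpart w)).

Definition lift1_vf (X : vcomp M) : vcomp (T2 M) := fun i w =>
  row_mx (row_mx 0 (X i (xpart w))) (lift1 (X i) (xpart w) (ypart w)).

Definition lift2_vf (X : vcomp M) : vcomp (T2 M) := fun i w =>
  row_mx (row_mx (X i (xpart w)) (lift1 (X i) (xpart w) (ypart w)))
         (lift2 (X i) (xpart w) (ypart w) (zpart w)).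

(* JJ is the 2-nd lift of J *)
Definition is_lift2_11 (J : mcomp M) (JJ : mcomp (T2 M)) : Prop :=
  tensor11 JJ /\
  (forall X : vcomp M, vector_field X ->
   forall i w, chart_image i w ->
     [/\ app JJ (lift2_vf X) i w = lift2_vf (app J X) i w,
         app JJ (lift1_vf X) i w = lift1_vf (app J X) i w &
         app JJ (lift0_vf X) i w = lift0_vf (app J X) i w]).

Definition deformed_lift2 (g c : mcomp M) : mcomp (T2 M) := fun i w =>
  let x := xpart w in let y := ypart w in let z := zpart w in
  block_mx
    (block_mx (lift2 (g i) x y z + c i x) (lift1 (g i) x y)
              (lift1 (g i) x y)           (g i x))
    (col_mx (g i x) 0)
    (row_mx (g i x) 0)
    0.

End Lifts.

(* Main.v *)
Require Import Defs.
From HB Require Import structures.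
From mathcomp Require Import all_boot all_order all_algebra.
From mathcomp Require Import boolp classical_sets functions cardinality reals.
From mathcomp Require Import topology normedtype landau derive sequences realfun exp.
From mathcomp Require Import ring lra zify.

(** Two facts carry the proof.

    First, a metric [g] that is pure for [J] satisfies [nabla J = 0] exactly
    when the Tachibana operator vanishes on it, that is, when [g] is itself a
    holomorphic tensor field ([anti_kahlerP]).  At each point this is linear
    algebra: the components of the Tachibana operator and those of [nabla J],
    lowered by [g], are combinations of each other ([nabla_phi_algebra]).  The
    equivalence is used twice, on the base and on the bundle, and spares the
    computation of the Levi-Civita connection of the lifted metric.

    Second, induced coordinates [(x, y, z)] stand for the point
    [x + e y + e^2 z] with [e^3 = 0], and a function [f] of [x] prolongs to
    [f (x + e y + e^2 z)], whose coefficients are [f], [lift1 f] and [lift2 f].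
    Prolongation commutes with products, with partial derivatives and with
    changes of coordinates ([prolong_mul], [pd_prolong], [prolong_comp]).  Give
    [x], [y], [z] the weights 0, 1, 2.  The entry of the lift of [J] in row
    weight [p] and column weight [q] is the coefficient of weight [q - p] of an
    entry of [J] ([is_lift2_11E]); the entry of the metric in weights [p] and
    [q] is the coefficient of weight [2 - (p + q)] of an entry of [g], plus the
    coefficient of weight [0 - (p + q)] of an entry of [c]
    ([deformed_lift2E]).  Both summands are thus instances of one construction,
    [mlift], which commutes with products, with changes of coordinates and with
    the Tachibana operator ([jlift_mlift], [mlift_comp], [phi_lift]).  Hence
    the purity defect and the Tachibana operator of the lifted metric are sums
    of lifts of those of [g], which vanish, and of those of [c], which are just
    pulled back from the base.

    The definitions test tensors on global vector fields.  Identities between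
    components follow from fields that are constant near a given point of a
    chart; extending them by zero uses a bump function and the Hausdorff
    property ([local_constant_field]).  This applies to the bundle too, once
    it is known to be a manifold ([T2_manifold]): jets with given coordinates
    are realized by quadratic curves cut off inside a chart ([curve_of_jet]),
    and the coordinates of jets change by the prolongation of the transition
    maps ([jet0_comp]). *)

Set Implicit Arguments.
Unset Strict Implicit.
Unset Printing Implicit Defensive.

Import Order.TTheory GRing.Theory Num.Theory.
Import numFieldNormedType.Exports.

Local Open Scope classical_set_scope.
Local Open Scope ring_scope.

(** * Smooth maps between normed spaces *)

Section Differentiation.
Context {R : realType}.
Implicit Types (V W : normedModType R).

Lemma near_eq_differentiable V W (f g : V -> W) x :
  (\forall u \near x, f u = g u) -> differentiable f x -> differentiable g x.
Proof.
move=> fg df.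
have H : g \o shift x = cst (g x) + 'd f x +o_ 0 id.
  apply/eqaddoP => e e0; have /eqaddoP/(_ e e0) := diff_locally df.
  apply: filter_app.
  have : \forall h \near (0 : V), f (h + x) = g (h + x).
    by move: fg; rewrite (near_shift 0) /=; under [X in X -> _]eq_near do rewrite subr0.
  apply: filterS => h /= fgh.
  by rewrite !fctE /= -(nbhs_singleton fg) fgh.
have dgE := diff_unique (diff_continuous df) H.
apply/diff_locallyP; rewrite dgE; split => //; exact: diff_continuous.
Qed.

Lemma open_near V (A : set V) (P : V -> Prop) x :
  open A -> A x -> (forall u, A u -> P u) -> \forall u \near x, P u.
Proof.
move=> oA Ax AP; have : \forall u \near x, A u by exact: open_nbhs_nbhs.
by apply: filterS.
Qed.

Lemma differentiable_mx V m n (f : V -> 'M[R]_(m, n)) x :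
  differentiable f x <-> forall i j, differentiable (fun u => f u i j) x.
Proof.
split=> [df i j|df].
  apply: (@differentiable_comp _ _ _ _ f (fun N : 'M[R]_(m, n) => N i j)) => //.
  exact: differentiable_coord.
have -> : f = \sum_i \sum_j (fun u => f u i j *: delta_mx i j).
  apply/funext => u; rewrite fct_sumE [LHS]matrix_sum_delta.
  by apply: eq_bigr => i _; rewrite fct_sumE.
apply: differentiable_sum => i; apply: differentiable_sum => j.
exact: differentiableZl.
Qed.

End Differentiation.

(** [smooth_on] quantifies over all lists of directions; with the order [k] of
    differentiation made explicit, each closure property below is an induction
    on [k]. *)
Section Ck.
Context {R : realType}.
Implicit Types (V W : normedModType R).

Fixpoint Ck V W (k : nat) (A : set V) (f : V -> W) : Prop :=
  (forall x, A x -> differentiable f x) /\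
  if k is k'.+1 then forall v, Ck k' A ('D_v f) else True.

Lemma Ck_diff V W k (A : set V) (f : V -> W) x :
  Ck k A f -> A x -> differentiable f x.
Proof. by case: k => [|k] [df _]; apply: df. Qed.

Lemma Ck_derive V W k (A : set V) (f : V -> W) v :
  Ck k.+1 A f -> Ck k A ('D_v f).
Proof. by case=> _; apply. Qed.

Lemma CkW V W k (A : set V) (f : V -> W) : Ck k.+1 A f -> Ck k A f.
Proof.
elim: k f => [|k IH] f [df Df]; split => //.
by move=> v; apply: IH.
Qed.

Lemma smooth_Ck V W (A : set V) (f : V -> W) :
  smooth_on A f <-> forall k, Ck k A f.
Proof.
split=> [sf k|Cf s x Ax].
  elim: k f sf => [|k IH] f sf; split => //; try exact: (sf [::]).
  move=> v; apply: IH => s x Ax.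
  by have := sf (rcons s v) x Ax; rewrite foldr_rcons.
elim/last_ind: s f Cf => [|s v IH] f Cf; first exact: Ck_diff (Cf 0%N) Ax.
by rewrite foldr_rcons; apply: IH => k; apply: Ck_derive.
Qed.

Lemma smooth_onS V W (A B : set V) (f : V -> W) :
  B `<=` A -> smooth_on A f -> smooth_on B f.
Proof. by move=> BA sf s x /BA; apply: sf. Qed.

Lemma smooth_diff V W (A : set V) (f : V -> W) x :
  smooth_on A f -> A x -> differentiable f x.
Proof. by move=> sf Ax; apply: (sf [::]). Qed.

Lemma smooth_derive V W (A : set V) (f : V -> W) v :
  smooth_on A f -> smooth_on A ('D_v f).
Proof. by move=> sf s x Ax; have := sf (rcons s v) x Ax; rewrite foldr_rcons. Qed.

Lemma smooth_local V W (A : set V) (f : V -> W) :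
  (forall x, A x -> exists2 U : set V, U x & smooth_on U f) -> smooth_on A f.
Proof. by move=> H s x /H [U Ux]; apply. Qed.

Lemma Ck_ext V W k (A : set V) (f g : V -> W) : open A ->
  (forall x, A x -> f x = g x) -> Ck k A f -> Ck k A g.
Proof.
move=> oA; elim: k f g => [|k IH] f g fg [df Df]; split => //.
- by move=> x Ax; apply: near_eq_differentiable (df x Ax); exact: open_near fg.
- by move=> x Ax; apply: near_eq_differentiable (df x Ax); exact: open_near fg.
- move=> v; apply: IH (Df v) => x Ax.
  by apply: near_eq_derive; exact: open_near fg.
Qed.

Lemma Ck_cst V W k (A : set V) (a : W) : Ck k A (cst a).
Proof.
elim: k a => [|k IH] a; split=> // v.
by have -> : 'D_v (cst a) = cst (0 : W) by apply/funext => x; rewrite derive_cst.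
Qed.

Lemma Ck_add V W k (A : set V) (f g : V -> W) : open A ->
  Ck k A f -> Ck k A g -> Ck k A (f + g).
Proof.
move=> oA; elim: k f g => [|k IH] f g [df Df] [dg Dg]; split=> //;
  try by move=> x Ax; apply: differentiableD; [exact: df|exact: dg].
move=> v; apply: (Ck_ext oA _ (IH _ _ (Df v) (Dg v))) => x Ax.
by rewrite deriveD //; apply: diff_derivable; [exact: df|exact: dg].
Qed.

Lemma Ck_mul V k (A : set V) (f g : V -> R) : open A ->
  Ck k A f -> Ck k A g -> Ck k A (f * g).
Proof.
move=> oA; elim: k f g => [|k IH] f g [df Df] [dg Dg]; split=> //;
  try by move=> x Ax; apply: differentiableM; [exact: df|exact: dg].
move=> v; have Cf : Ck k A f by apply: CkW.
have Cg : Ck k A g by apply: CkW.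
apply: (Ck_ext oA _ (Ck_add oA (IH _ _ Cf (Dg v)) (IH _ _ (Df v) Cg))) => x Ax.
rewrite deriveM; [|exact/diff_derivable/df
                  |exact/diff_derivable/dg].
by rewrite /GRing.add /= /GRing.mul /= /GRing.scale /= [X in _ + X]mulrC.
Qed.

Lemma derive_mxE V m n (f : V -> 'M[R]_(m, n)) x v i j :
  differentiable f x -> 'D_v f x i j = 'D_v (fun u => f u i j) x.
Proof. by move=> df; rewrite derive_mx ?mxE //; exact: diff_derivable. Qed.

Lemma Ck_mx V k m n (A : set V) (f : V -> 'M[R]_(m, n)) : open A ->
  Ck k A f <-> forall i j, Ck k A (fun u => f u i j).
Proof.
move=> oA; elim: k f => [|k IH] f; split.
- by case=> df _ i j; split=> // x Ax; have /differentiable_mx := df x Ax.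
- move=> H; split=> // x Ax; apply/differentiable_mx => i j.
  by case: (H i j) => df _; apply: df.
- case=> df Df i j; split=> [x Ax|v]; first by have /differentiable_mx := df x Ax.
  have /IH/(_ i j) := Df v; apply: Ck_ext => // x Ax.
  by rewrite derive_mxE //; apply: df.
- move=> H.
  have df x : A x -> differentiable f x.
    by move=> Ax; apply/differentiable_mx => i j; exact: Ck_diff (H i j) Ax.
  split=> // v; apply/IH => i j.
  apply: (Ck_ext oA _ (Ck_derive v (H i j))) => x Ax.
  by rewrite derive_mxE //; apply: df.
Qed.

Lemma smooth_ext V W (A : set V) (f g : V -> W) : open A ->
  (forall x, A x -> f x = g x) -> smooth_on A f -> smooth_on A g.
Proof. by move=> oA fg /smooth_Ck Cf; apply/smooth_Ck => k; exact: Ck_ext fg _. Qed.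

Lemma smooth_cst V W (A : set V) (a : W) : smooth_on A (fun=> a).
Proof. by apply/smooth_Ck => k; exact: Ck_cst. Qed.

Lemma smooth_add V W (A : set V) (f g : V -> W) : open A ->
  smooth_on A f -> smooth_on A g -> smooth_on A (fun x => f x + g x).
Proof.
by move=> oA /smooth_Ck Cf /smooth_Ck Cg; apply/smooth_Ck => k; exact: Ck_add.
Qed.

Lemma smooth_mul V (A : set V) (f g : V -> R) : open A ->
  smooth_on A f -> smooth_on A g -> smooth_on A (fun x => f x * g x).
Proof.
by move=> oA /smooth_Ck Cf /smooth_Ck Cg; apply/smooth_Ck => k; exact: Ck_mul.
Qed.

Lemma smooth_sum V W (I : Type) (r : seq I) (P : pred I) (A : set V)
    (f : I -> V -> W) : open A ->
  (forall i, smooth_on A (f i)) -> smooth_on A (fun x => \sum_(i <- r | P i) f i x).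
Proof.
move=> oA sf; elim: r => [|i r IH].
  by under eq_fun do rewrite big_nil; exact: smooth_cst.
under eq_fun do rewrite big_cons; case: (P i) => //.
exact: smooth_add.
Qed.

Lemma smooth_mx V m n (A : set V) (f : V -> 'M[R]_(m, n)) : open A ->
  smooth_on A f <-> forall i j, smooth_on A (fun u => f u i j).
Proof.
move=> oA; split=> [/smooth_Ck Cf i j|sf].
  by apply/smooth_Ck => k; move: i j; apply/Ck_mx.
apply/smooth_Ck => k; apply/Ck_mx => // i j.
by have /smooth_Ck := sf i j.
Qed.

Lemma smooth_opp V (A : set V) (f : V -> R) : open A ->
  smooth_on A f -> smooth_on A (fun x => - f x).
Proof.
move=> oA sf; apply: (smooth_ext oA (f := fun x => -1 * f x)).
  by move=> x _; rewrite mulN1r.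
by apply: smooth_mul => //; exact: smooth_cst.
Qed.

Lemma linear_smooth V W (A : set V) (f : {linear V -> W}) :
  continuous f -> smooth_on A f.
Proof.
move=> cf; apply/smooth_Ck => -[|k]; split => //;
  try by move=> x _; exact: linear_differentiable.
move=> v; have -> : 'D_v f = cst (f v).
  apply/funext => x; rewrite deriveE; last exact: linear_differentiable.
  by rewrite diff_lin.
exact: Ck_cst.
Qed.

Lemma coord_smooth m n (A : set 'M[R]_(m, n)) i j :
  smooth_on A (fun N : 'M[R]_(m, n) => N i j).
Proof.
have @f : {linear 'M[R]_(m, n) -> R}.
  by exists (fun N : 'M[R]_(_, _) => N i j); do 2![eexists]; do ?[constructor];
     rewrite ?mxE// => ? *; rewrite ?mxE//; move=> ?; rewrite !mxE.
by have := @linear_smooth _ _ A f (@coord_continuous _ _ _ i j).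
Qed.

Lemma id_smooth V (A : set V) : smooth_on A (fun x : V => x).
Proof. by apply: (@linear_smooth _ _ A idfun) => x; exact: cvg_id. Qed.

End Ck.

(** * Composition of smooth maps *)

Section ChainRule.
Context {R : realType}.
Implicit Types (U V W : normedModType R).

(** Directions are expanded on a finite family [b] with coordinates [co], so
    that the derivative of a composite becomes a finite sum of products; the
    cases of interest are row vectors and the line. *)
Section FiniteBasis.
Variables (U V : normedModType R) (n : nat) (b : 'I_n -> V) (co : 'I_n -> V -> R).
Hypothesis bE : forall v, v = \sum_s co s v *: b s.
Hypothesis coD : forall s (g : U -> V) x u, differentiable g x ->
  co s ('D_u g x) = 'D_u (fun x => co s (g x)) x.

Lemma derive_comp_basis (f : V -> R) (g : U -> V) x u :
  differentiable g x -> differentiable f (g x) ->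
  'D_u (f \o g) x = \sum_s 'D_u (fun x => co s (g x)) x * 'D_(b s) f (g x).
Proof.
move=> dg df; rewrite deriveE; last exact: differentiable_comp.
rewrite diff_comp //= -(deriveE u dg) [X in 'd f _ X]bE linear_sum /=.
by apply: eq_bigr => s _; rewrite linearZ /= coD // (deriveE (b s) df).
Qed.

Lemma Ck_comp_basis k (A : set U) (B : set V) (f : V -> R) (g : U -> V) :
  open A -> (forall x, A x -> B (g x)) -> Ck k B f -> Ck k A g ->
  (forall s, Ck k A (fun x => co s (g x))) -> Ck k A (f \o g).
Proof.
move=> oA AB; elim: k f => [|k IH] f Cf Cg Cco.
  split=> // x Ax; apply: differentiable_comp; first exact: Ck_diff Cg Ax.
  exact: Ck_diff Cf (AB _ Ax).
have dfg x : A x -> differentiable (f \o g) x.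
  move=> Ax; apply: differentiable_comp; first exact: Ck_diff Cg Ax.
  exact: Ck_diff Cf (AB _ Ax).
split=> // u.
apply: (@Ck_ext _ _ _ _ _ (\sum_s ('D_u (fun x => co s (g x)) * ('D_(b s) f \o g)))) => //.
  move=> x Ax; rewrite derive_comp_basis; last 2 first.
  - exact: Ck_diff Cg Ax.
  - exact: Ck_diff Cf (AB _ Ax).
  by rewrite fct_sumE.
elim/big_ind: _ => [||s _]; [exact: Ck_cst|by move=> ? ? ? ?; apply: Ck_add|].
apply: Ck_mul => //; first exact: Ck_derive.
apply: IH; [exact: Ck_derive|exact: CkW|].
by move=> s'; apply: CkW.
Qed.

End FiniteBasis.

Lemma row_basis n (v : 'rV[R]_n) : v = \sum_s v 0 s *: delta_mx 0 s.
Proof. exact: row_sum_delta. Qed.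

Lemma derive_comp_row U n (f : 'rV[R]_n -> R) (g : U -> 'rV[R]_n) x u :
  differentiable g x -> differentiable f (g x) ->
  'D_u (fun x => f (g x)) x =
    \sum_s 'D_u (fun x => g x 0 s) x * partial s f (g x).
Proof.
apply: (@derive_comp_basis U _ n (delta_mx 0) (fun s v => v 0 s)).
  exact: row_basis.
by move=> s h y w; apply: derive_mxE.
Qed.

Lemma derive_row n (f : 'rV[R]_n -> R) x v :
  differentiable f x -> 'D_v f x = \sum_s v 0 s * partial s f x.
Proof.
move=> df; rewrite deriveE // [X in 'd f x X]row_sum_delta linear_sum /=.
by apply: eq_bigr => s _; rewrite linearZ /= /partial deriveE.
Qed.

Lemma smooth_comp_row U n m p (A : set U) (B : set 'rV[R]_n)
    (f : 'rV[R]_n -> 'M[R]_(m, p)) (g : U -> 'rV[R]_n) :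
  open A -> open B -> (forall x, A x -> B (g x)) ->
  smooth_on B f -> smooth_on A g -> smooth_on A (fun x => f (g x)).
Proof.
move=> oA oB AB /smooth_mx sf sg; apply/smooth_mx => // i j.
have /smooth_Ck Cg := sg; have /smooth_Ck Cf := sf oB i j.
apply/smooth_Ck => k.
apply: (@Ck_comp_basis U _ n (delta_mx 0) (fun s v => v 0 s) (@row_basis n)
         _ k A B _ _ oA AB (Cf k) (Cg k)).
  by move=> s h x u; apply: derive_mxE.
by move=> s; exact: ((Ck_mx k g oA).1 (Cg k)).
Qed.

Lemma smooth_comp_row_scalar U n (A : set U) (B : set 'rV[R]_n)
    (f : 'rV[R]_n -> R) (g : U -> 'rV[R]_n) :
  open A -> (forall x, A x -> B (g x)) ->
  smooth_on B f -> smooth_on A g -> smooth_on A (fun x => f (g x)).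
Proof.
move=> oA AB /smooth_Ck Cf /smooth_Ck Cg; apply/smooth_Ck => k.
apply: (@Ck_comp_basis U _ n (delta_mx 0) (fun s v => v 0 s) (@row_basis n)
         _ k A B _ _ oA AB (Cf k) (Cg k)).
  by move=> s h x u; apply: derive_mxE.
by move=> s; exact: ((Ck_mx k g oA).1 (Cg k)).
Qed.

Lemma smooth_comp_real U (A : set U) (B : set R) (f : R -> R) (g : U -> R) :
  open A -> (forall x, A x -> B (g x)) ->
  smooth_on B f -> smooth_on A g -> smooth_on A (fun x => f (g x)).
Proof.
move=> oA AB /smooth_Ck Cf /smooth_Ck Cg; apply/smooth_Ck => k.
have bE (v : R) : v = \sum_(s < 1) v *: (1 : R) by rewrite big_ord1 [RHS]mulr1.
have coD (s : 'I_1) (h : U -> R) x u : differentiable h x ->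
    'D_u h x = 'D_u (fun x => h x) x by [].
exact: (Ck_comp_basis bE coD oA AB (Cf k) (Cg k)).
Qed.

End ChainRule.

(** * Symmetry of second derivatives *)

Section Schwarz.
Context {R : realType}.
Implicit Types V : normedModType R.

Lemma is_derive_line V (f : V -> R) p w (s : R) :
  differentiable f (p + s *: w) ->
  is_derive s 1 (fun t : R => f (p + t *: w)) ('D_w f (p + s *: w)).
Proof.
move=> df.
have E : (fun h => h^-1 *: (((fun t : R => f (p + t *: w)) \o shift s) (h *: 1) -
                            f (p + s *: w))) =
         (fun h => h^-1 *: ((f \o shift (p + s *: w)) (h *: w) - f (p + s *: w))).
  apply/funext => h /=; congr (_ *: (f _ - _)).
  by rewrite [h%:A]mulr1 scalerDl addrCA.
have := diff_derivable df (v := w); rewrite /derivable => dfw.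
by apply: DeriveDef; rewrite /derivable /derive E.
Qed.

(** Restricting [f] to a line reduces several variables to the mean value
    theorem of one. *)
Lemma mvt_line V (f : V -> R) p w (h : R) : 0 < h ->
  (forall s : R, 0 <= s <= h -> differentiable f (p + s *: w)) ->
  exists2 s, 0 <= s <= h & f (p + h *: w) - f p = h * 'D_w f (p + s *: w).
Proof.
move=> h0 df.
have [||s] := @MVT R (fun t => f (p + t *: w)) (fun s => 'D_w f (p + s *: w)) 0 h h0.
- move=> s; rewrite in_itv /= => /andP[/ltW s0 /ltW sh].
  by apply: is_derive_line; apply: df; rewrite s0.
- apply: derivable_within_continuous => s; rewrite in_itv /= => sh.
  by have [] := is_derive_line (df _ sh).
rewrite in_itv /= => /andP[/ltW s0 /ltW sh].
rewrite scale0r addr0 subr0 mulrC => E; exists s; by rewrite ?s0.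
Qed.

(** Both iterated derivatives are limits of the same second difference
    quotient, by two applications of the mean value theorem. *)
Lemma second_difference V (A : set V) (f : V -> R) x u v (h : R) : 0 < h ->
  smooth_on A f ->
  (forall s t : R, 0 <= s <= h -> 0 <= t <= h -> A (x + s *: u + t *: v)) ->
  exists s t : R, [/\ 0 <= s <= h, 0 <= t <= h &
    f (x + h *: u + h *: v) - f (x + h *: v) - (f (x + h *: u) - f x) =
    h * (h * 'D_v ('D_u f) (x + s *: u + t *: v))].
Proof.
move=> h0 sf Ah; pose g p := f (p + h *: v) - f p.
have hh : 0 <= h <= h by apply/andP; split => //; exact: ltW.
have zh : 0 <= (0 : R) <= h by apply/andP; split => //; exact: ltW.
have df s t : 0 <= s <= h -> 0 <= t <= h -> differentiable f (x + s *: u + t *: v).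
  by move=> sh th; apply: smooth_diff sf _; exact: Ah.
have df0 s : 0 <= s <= h -> differentiable f (x + s *: u).
  by move=> sh; have := df s 0 sh zh; rewrite scale0r addr0.
have dsh s : 0 <= s <= h -> differentiable (fun p => f (p + h *: v)) (x + s *: u).
  move=> sh; apply: (@differentiable_comp _ _ _ _ (fun p => p + h *: v) f).
    by apply: (@differentiableD _ _ _ id (cst (h *: v))).
  exact: df.
have dg s : 0 <= s <= h -> differentiable g (x + s *: u).
  by move=> sh; apply: differentiableB; [exact: dsh|exact: df0].
have [s sh E1] := mvt_line h0 dg.
have Dg : 'D_u g (x + s *: u) = 'D_u f (x + s *: u + h *: v) - 'D_u f (x + s *: u).
  have D1 : derivable (fun p => f (p + h *: v)) (x + s *: u) u.
    by exact/diff_derivable/dsh.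
  have D2 : derivable f (x + s *: u) u by exact/diff_derivable/df0.
  have D1E : 'D_u (fun p => f (p + h *: v)) (x + s *: u) =
             'D_u f (x + s *: u + h *: v).
    rewrite /derive (_ : (fun k => _) = (fun k => k^-1 *:
      ((f \o shift (x + s *: u + h *: v)) (k *: u) - f (x + s *: u + h *: v)))) //.
    by apply/funext => k /=; rewrite !addrA.
  by rewrite -D1E; exact: deriveB D1 D2.
have dDu t : 0 <= t <= h -> differentiable ('D_u f) (x + s *: u + t *: v).
  by move=> th; apply: smooth_diff (smooth_derive u sf) _; exact: Ah.
have [t th E2] := mvt_line h0 dDu.
exists s, t; split=> //.
have swap (a b c d : R) : a - b - (c - d) = a - c - (b - d) by ring.
by rewrite -E2 -Dg -E1 /g swap.
Qed.

Lemma smooth_continuous V (A : set V) (f : V -> R) x :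
  smooth_on A f -> A x -> {for x, continuous f}.
Proof. by move=> sf Ax; apply: differentiable_continuous; exact: smooth_diff Ax. Qed.

(** By [second_difference], in both orders, every neighbourhood of [x] contains
    two points at which the two iterated derivatives agree; their continuity at
    [x] concludes. *)
Lemma derive_comm V (A : set V) (f : V -> R) x u v : open A -> A x ->
  smooth_on A f -> 'D_v ('D_u f) x = 'D_u ('D_v f) x.
Proof.
move=> oA Ax sf.
apply/eqP; rewrite -subr_eq0 -normr_le0; apply/ler_addgt0Pr => e e0; rewrite add0r.
have e2 : 0 < e / 2 by rewrite divr_gt0.
have [sa sb] := (smooth_derive v (smooth_derive u sf), smooth_derive u (smooth_derive v sf)).
have ca := smooth_continuous sa Ax; have cb := smooth_continuous sb Ax.
have near_point (a b c : R) :
    `|a - c| < e / 2 -> `|b - c| < e / 2 -> `|a - b| <= e.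
  move=> ac bc; apply: (le_trans (ler_distD c _ _)); apply: ltW.
  by rewrite (splitr e) ltrD // distrC.
have nA : \forall p \near x, A p by exact: open_nbhs_nbhs.
have na : \forall p \near x, `|'D_v ('D_u f) x - 'D_v ('D_u f) p| < e / 2.
  by move/cvgrPdist_lt : ca; apply.
have nb : \forall p \near x, `|'D_u ('D_v f) x - 'D_u ('D_v f) p| < e / 2.
  by move/cvgrPdist_lt : cb; apply.
have [d /= d0 Hd] := (nbhs_ballP _ _).1 (filterI nA (filterI na nb)).
(* Small enough for the parallelogram with sides h u and h v to stay in the ball. *)
pose h := d / (1 + `|u| + `|v|).
have N0 : 0 < 1 + `|u| + `|v| by rewrite -addrA ltr_wpDr // addr_ge0.
have h0 : 0 < h by rewrite divr_gt0.
have inb (s t : R) : 0 <= s <= h -> 0 <= t <= h -> ball x d (x + s *: u + t *: v).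
  move=> /andP[s0 sh] /andP[t0 th]; rewrite -ball_normE /= -addrA opprD addNKr normrN.
  apply: (le_lt_trans (ler_normD _ _)); rewrite !normrZ !ger0_norm //.
  apply: (@le_lt_trans _ _ (h * (`|u| + `|v|))).
    by rewrite mulrDr lerD // ler_wpM2r.
  by rewrite mulrAC ltr_pdivrMr // ltr_pM2l // -addrA ltrDr.
have inb' (s t : R) : 0 <= s <= h -> 0 <= t <= h -> A (x + s *: v + t *: u).
  by move=> a b; rewrite addrAC; have [] := Hd _ (inb t s b a).
have [s [t [sh th E1]]] := second_difference h0 sf (fun s t a b => (Hd _ (inb s t a b)).1).
have [t' [s' [th' sh' E2]]] := second_difference h0 sf inb'.
have [_ [H1 _]] := Hd _ (inb _ _ sh th).
have [_ [_ H2]] := Hd _ (inb _ _ sh' th').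
have hn : h != 0 by rewrite gt_eqF.
have swap (i j k l : R) : i - j - (k - l) = i - k - (j - l) by ring.
move: E2; rewrite [x + h *: v + h *: u]addrAC swap E1.
move=> /(mulfI hn) /(mulfI hn) E; move: H1.
rewrite E [x + t' *: v + _]addrAC => H1.
exact: near_point H1 H2.
Qed.
End Schwarz.

(** * A smooth plateau function *)

Section Bump.
Context {R : realType}.

(** For [p = 1] this is the standard smooth function that is flat at [0]; with
    a polynomial factor the family is stable under differentiation. *)
Definition flat (p : {poly R}) (t : R) : R :=
  if 0 < t then p.[t^-1] * expR (- t^-1) else 0.

(** The exponential dominates each monomial, since [s ^ k / k! <= exp s]. *)
Lemma horner_le_expR (p : {poly R}) :
  exists2 C : R, 0 <= C & forall s, 0 <= s -> `|p.[s]| <= C * expR s.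
Proof.
exists (\sum_(i < size p) `|p`_i| * (i`!)%:R).
  by apply: sumr_ge0 => i _; rewrite mulr_ge0.
move=> s s0; rewrite horner_coef mulr_suml (le_trans (ler_norm_sum _ _ _)) //.
apply: ler_sum => i _; rewrite normrM -mulrA ler_wpM2l //.
rewrite ger0_norm ?exprn_ge0 //; case: (nat_of_ord i) => [|k].
  rewrite expr0 fact0 mul1r (le_trans _ (expR_ge1Dx s)) // lerDl //.
rewrite mulrC -ler_pdivrMr ?ltr0n ?fact_gt0 //.
by rewrite (le_trans _ (expR_ge1Dxn k s0)) // lerDr.
Qed.

(** With [s = 1 / t], the bound of the polynomial [p * X^2] by the exponential
    reads [flat p t = O(t^2)]; this gives differentiability at [0]. *)
Lemma flat_le_sqr p : exists2 C : R, 0 <= C & forall t, `|flat p t| <= C * t ^+ 2.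
Proof.
have [C C0 HC] := horner_le_expR (p * 'X^2); exists C => // t.
rewrite /flat; case: ifPn => [t0|_]; last by rewrite normr0 mulr_ge0 ?sqr_ge0.
have s0 : 0 <= t^-1 by rewrite invr_ge0 ltW.
have := HC _ s0; rewrite hornerM hornerXn normrM.
rewrite [X in _ * X <= _]ger0_norm ?exprn_ge0 //.
rewrite exprVn ler_pdivrMr ?exprn_gt0 // => H.
rewrite normrM (ger0_norm (expR_ge0 _)) // expRN ler_pdivrMr ?expR_gt0 //.
by rewrite mulrAC.
Qed.

(** [d/dt (p(1/t) exp(-1/t)) = t^-2 (p - p')(1/t) exp(-1/t)]. *)
Definition flat_diff (p : {poly R}) : {poly R} := 'X^2 * (p - p^`()).

Lemma is_derive_flat (p : {poly R}) (t : R) : is_derive t 1 (flat p) (flat (flat_diff p) t).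
Proof.
have [t0|t0|<-] := ltgtP 0 t.
- have tn : t != 0 by rewrite gt_eqF.
  rewrite {2}/flat t0.
  apply: (@near_eq_is_derive _ _ _
      ((fun u : R => p.[u^-1]) * (fun u : R => expR (- u^-1)))).
    near=> u; rewrite /flat ifT //; near: u; exact: lt_nbhsr.
  have dV : is_derive t 1 (fun u : R => u^-1) (- t ^- 2).
    apply: DeriveDef; first exact: derivableV.
    by rewrite deriveV // derive_id [LHS]mulr1.
  have dp : is_derive t 1 (fun u : R => p.[u^-1]) (p^`().[t^-1] * - t ^- 2).
    have -> : (fun u : R => p.[u^-1]) = horner p \o (fun u : R => u^-1) by [].
    exact: is_derive1_comp.
  have de : is_derive t 1 (fun u : R => expR (- u^-1)) (expR (- t^-1) * t ^- 2).
    have -> : (fun u : R => expR (- u^-1)) = expR \o (fun u : R => - u^-1) by [].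
    rewrite -[t ^- 2]opprK; apply: is_derive1_comp.
  apply: is_derive_eq; rewrite /flat_diff hornerM hornerXn hornerD hornerN exprVn.
  by rewrite /GRing.scale /=; ring.
- rewrite {2}/flat ifF; last by apply: negbTE; rewrite -leNgt ltW.
  apply: (@near_eq_is_derive _ _ _ (cst 0)).
  near=> u; rewrite /flat ifF //; apply: negbTE; rewrite -leNgt ltW //.
  by near: u; exact: lt_nbhsl.
- rewrite {2}/flat ltxx.
  have [C C0 HC] := flat_le_sqr p.
  have f0 : flat p 0 = 0 by rewrite /flat ltxx.
  have lim0 : h^-1 *: ((flat p \o shift 0) (h *: 1) - flat p 0) @[h --> 0^'] --> (0 : R).
    apply/cvgrPdist_le => e e0; near=> h.
    have hn : h != 0 by near: h; exact: nbhs_dnbhs_neq.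
    have he : `|h| <= e / (C + 1).
      by near: h; apply: dnbhs0_le; rewrite divr_gt0 // ltr_wpDl.
    rewrite sub0r normrN /= f0 subr0 addr0 [h%:A]mulr1 normrZ normfV.
    rewrite ler_pdivrMl ?normr_gt0 // (le_trans (HC h)) //.
    rewrite -real_normK ?num_real // expr2 mulrCA ler_wpM2l //.
    move: he; rewrite ler_pdivlMr ?ltr_wpDl // => he; apply: le_trans he.
    by rewrite mulrC ler_wpM2l // lerDl.
  apply: DeriveDef; first by apply/cvg_ex; exists 0.
  exact/cvg_lim.
Unshelve. all: by end_near. Qed.

Lemma smooth_flat p : smooth_on setT (flat p).
Proof.
apply/smooth_Ck => k; elim: k p => [|k IH] p; split=> //;
  try by move=> x _; apply/derivable1_diffP; have [] := is_derive_flat p x.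
move=> v; apply: (@Ck_ext _ _ _ _ _ (cst v * flat (flat_diff p))) => //.
- exact: openT.
- move=> x _; rewrite deriveE; last first.
    by apply/derivable1_diffP; have [] := is_derive_flat p x.
  rewrite -[X in 'd _ _ X](mulr1 v) -[X in 'd _ _ X]/(v *: (1 : R)) linearZ /=.
  rewrite -deriveE; last by apply/derivable1_diffP; have [] := is_derive_flat p x.
  by have [_ ->] := is_derive_flat p x.
- apply: Ck_mul; [exact: openT|exact: Ck_cst|exact: IH].
Qed.

Let h := flat 1.

Let hE t : h t = if 0 < t then expR (- t^-1) else 0.
Proof. by rewrite /h /flat hornerC; case: ifP => // _; rewrite mul1r. Qed.

Let h_ge0 t : 0 <= h t.
Proof. by rewrite hE; case: ifP => // _; exact: expR_ge0. Qed.

Let h1_gt0 : 0 < h 1.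
Proof. by rewrite hE ltr01 expR_gt0. Qed.

Let h_le1 t : t <= 1 -> h t <= h 1.
Proof.
move=> t1; rewrite [h t]hE; case: ifPn => [t0|_]; last exact: h_ge0.
rewrite hE ltr01 ler_expR lerN2 invr1 -[leLHS]invr1 lef_pV2 // posrE //.
Qed.

(** Composing the flat function with itself makes the plateau exact: no
    quotient of smooth functions is needed. *)
Definition plateau (r : R) : R := flat 1 (1 - flat 1 (r - 1) / flat 1 1) / flat 1 1.

Lemma plateau_ge0 r : 0 <= plateau r.
Proof. by rewrite divr_ge0 // ?h_ge0 ?ltW. Qed.

Lemma plateau_le1 r : plateau r <= 1.
Proof.
rewrite ler_pdivrMr // mul1r; apply: h_le1.
by rewrite gerBl divr_ge0 // ?h_ge0 ?ltW.
Qed.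

Lemma plateau1 r : r <= 1 -> plateau r = 1.
Proof.
move=> r1; rewrite /plateau; have -> : flat 1 (r - 1) = 0.
  by rewrite -/h hE ifF //; apply: negbTE; rewrite -leNgt subr_le0.
by rewrite mul0r subr0 divff // gt_eqF.
Qed.

Lemma plateau0 r : 2 <= r -> plateau r = 0.
Proof.
move=> r2; rewrite /plateau [X in X / _](_ : _ = 0) ?mul0r //.
rewrite -!/h hE ifF //; apply: negbTE; rewrite -leNgt subr_le0.
rewrite ler_pdivlMr // mul1r !hE ltr01.
have r1 : 1 <= r - 1 by rewrite lerBrDr.
rewrite ifT; last exact: lt_le_trans r1.
rewrite ler_expR lerN2 lef_pV2 ?posrE //.
exact: lt_le_trans r1.
Qed.

Lemma smooth_plateau : smooth_on setT plateau.
Proof.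
have oT : open [set: R] by exact: openT.
have sc c : smooth_on setT (fun _ : R => c : R) by exact: smooth_cst.
apply: smooth_mul (oT) _ (sc _).
apply: (smooth_comp_real (B := setT)) => //; first exact: smooth_flat.
apply: smooth_add (oT) (sc _) _; apply: smooth_opp (oT) _.
apply: smooth_mul (oT) _ (sc _).
apply: (smooth_comp_real (B := setT)) => //; first exact: smooth_flat.
by apply: smooth_add (oT) _ (sc _); exact: id_smooth.
Qed.

End Bump.

(** * Derivatives of matrix-valued maps and the Tachibana operator *)

Section MatrixDerivative.
Context {R : realType}.
Implicit Types (V : normedModType R).

Lemma differentiable_mulmx V m n p (f : V -> 'M[R]_(m, n)) (g : V -> 'M[R]_(n, p)) x :
  differentiable f x -> differentiable g x ->
  differentiable (fun u => f u *m g u) x.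
Proof.
move=> /differentiable_mx df /differentiable_mx dg; apply/differentiable_mx => i j.
under eq_fun do rewrite mxE.
have -> : (fun u => \sum_k f u i k * g u k j) =
          \sum_k ((fun u => f u i k) * (fun u => g u k j)).
  by apply/funext => u; rewrite fct_sumE.
by apply: differentiable_sum => k; apply: differentiableM.
Qed.

Lemma differentiable_trmx V m n (f : V -> 'M[R]_(m, n)) x :
  differentiable f x -> differentiable (fun u => (f u)^T) x.
Proof.
move=> /differentiable_mx df; apply/differentiable_mx => i j.
by under eq_fun do rewrite mxE.
Qed.

Lemma derive_mul_scalar V (f g : V -> R) x v :
  differentiable f x -> differentiable g x ->
  'D_v (fun u => f u * g u) x = 'D_v f x * g x + f x * 'D_v g x.
Proof.
move=> df dg; have := deriveM (diff_derivable df (v := v)) (diff_derivable dg (v := v)).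
by rewrite /GRing.scale /= addrC [X in X + _]mulrC.
Qed.

Lemma derive_sum_scalar V (I : Type) (r : seq I) (P : pred I) (f : I -> V -> R) x v :
  (forall k, differentiable (f k) x) ->
  'D_v (fun u => \sum_(k <- r | P k) f k u) x = \sum_(k <- r | P k) 'D_v (f k) x.
Proof.
move=> df.
suff [_] : differentiable (fun u => \sum_(k <- r | P k) f k u) x /\
  'D_v (fun u => \sum_(k <- r | P k) f k u) x = \sum_(k <- r | P k) 'D_v (f k) x by [].
elim: r => [|k r [IHd IH]].
  under eq_fun do rewrite big_nil; rewrite big_nil; split.
    exact: differentiable_cst.
  exact: derive_cst.
rewrite big_cons; under eq_fun do rewrite big_cons; case: (P k) => //; split.
  exact: differentiableD.
by rewrite -IH; apply: deriveD; exact/diff_derivable.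
Qed.

Lemma derive_mulmx V m n p (f : V -> 'M[R]_(m, n)) (g : V -> 'M[R]_(n, p)) x v :
  differentiable f x -> differentiable g x ->
  'D_v (fun u => f u *m g u) x = 'D_v f x *m g x + f x *m 'D_v g x.
Proof.
move=> df dg; apply/matrixP => i j; rewrite derive_mxE; last exact: differentiable_mulmx.
have /differentiable_mx dfc := df; have /differentiable_mx dgc := dg.
under eq_fun do rewrite mxE.
rewrite derive_sum_scalar; last by move=> k; apply: differentiableM.
rewrite !mxE -big_split; apply: eq_bigr => k _ /=.
by rewrite derive_mul_scalar // !derive_mxE.
Qed.

Lemma derive_trmx V m n (f : V -> 'M[R]_(m, n)) x v :
  differentiable f x -> 'D_v (fun u => (f u)^T) x = ('D_v f x)^T.
Proof.
move=> df; apply/matrixP => i j.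
rewrite derive_mxE; last exact: differentiable_trmx.
by rewrite mxE derive_mxE //; under eq_fun do rewrite mxE.
Qed.

Lemma lift1E n (W : normedModType R) (f : 'rV[R]_n -> W) x v :
  differentiable f x -> lift1 f x v = 'D_v f x.
Proof.
move=> df; rewrite deriveE // [X in 'd f x X]row_sum_delta linear_sum /=.
by apply: eq_bigr => s _; rewrite linearZ /= /partial deriveE.
Qed.

Lemma derive_dirP n (W : normedModType R) (f : 'rV[R]_n -> W) x (a : R) u v :
  differentiable f x -> 'D_(a *: u + v) f x = a *: 'D_u f x + 'D_v f x.
Proof. by move=> df; rewrite !deriveE // linearP. Qed.

Lemma bilin_delta m n (A : 'M[R]_(m, n)) a b :
  ((delta_mx 0 a : 'rV_m) *m A *m (delta_mx 0 b : 'rV_n)^T) 0 0 = A a b.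
Proof. by rewrite -rowE trmx_delta -colE !mxE. Qed.

End MatrixDerivative.

Section TachibanaPointwise.
Context {R : realType} {n : nat}.
Implicit Types (J c g : 'rV[R]_n -> 'M[R]_n).

(** The components of the Tachibana operator: its values on coordinate
    fields. *)
Definition phi J c (k a b : 'I_n) (x : 'rV[R]_n) : R :=
  \sum_m J x k m * partial m (fun u => c u a b) x
  - partial k (fun u => (J u *m c u) a b) x
  + \sum_m partial a (fun u => J u k m) x * c x m b
  + \sum_m partial b (fun u => J u k m) x * c x a m.

Definition form (v : 'rV[R]_n) (A : 'M[R]_n) (w : 'rV[R]_n) : R :=
  (v *m A *m w^T) 0 0.

Lemma formPl r v v' A w : form (r *: v + v') A w = r * form v A w + form v' A w.
Proof. by rewrite /form !mulmxDl -!scalemxAl mxE [X in X + _]mxE. Qed.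

Lemma formPr r v A w w' : form v A (r *: w + w') = r * form v A w + form v A w'.
Proof. by rewrite /form linearP mulmxDr -!scalemxAr mxE [X in X + _]mxE. Qed.

Lemma formPm r v A A' w : form v (r *: A + A') w = r * form v A w + form v A' w.
Proof. by rewrite /form mulmxDr mulmxDl -scalemxAr -!scalemxAl mxE [X in X + _]mxE. Qed.

(** The Tachibana operator on constant vector fields. *)
Definition phi_form J c (x u v w : 'rV[R]_n) : R :=
  form v ('D_(u *m J x) c x) w
  - form v ('D_u (fun p => J p *m c p) x) w
  + form u ('D_v J x *m c x) w
  + form v (c x *m ('D_w J x)^T) u.

Lemma phi_form_delta J c k a b x : differentiable J x -> differentiable c x ->
  phi_form J c x (delta_mx 0 k) (delta_mx 0 a) (delta_mx 0 b) = phi J c k a b x.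
Proof.
move=> dJ dc; have dJc := differentiable_mulmx dJ dc.
have /differentiable_mx dcE := dc.
have -> : phi J c k a b x =
    'D_(delta_mx 0 k *m J x) c x a b
    - 'D_(delta_mx 0 k) (fun p => J p *m c p) x a b
    + ('D_(delta_mx 0 a) J x *m c x) k b
    + (c x *m ('D_(delta_mx 0 b) J x)^T) a k.
  rewrite /phi; congr (_ - _ + _ + _).
  - rewrite derive_mxE // derive_row //; apply: eq_bigr => m _.
    by rewrite -rowE mxE.
  - by rewrite derive_mxE.
  - by rewrite mxE; apply: eq_bigr => m _; rewrite derive_mxE.
  - by rewrite mxE; apply: eq_bigr => m _; rewrite mxE derive_mxE // mulrC.
by rewrite /phi_form; congr (_ - _ + _ + _); apply: bilin_delta.
Qed.

(** Used once per argument to reduce the trilinear [phi_form] to its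
    components. *)
Lemma linear_form_eq0 (f : 'rV[R]_n -> R) :
  (forall (a : R) u v, f (a *: u + v) = a * f u + f v) ->
  (forall k, f (delta_mx 0 k) = 0) -> forall u, f u = 0.
Proof.
move=> fl f0 u.
have f00 : f 0 = 0.
  have := fl 1 0 0; rewrite scaler0 add0r mul1r => /eqP.
  by rewrite -subr_eq0 opprD addrA subrr add0r oppr_eq0 => /eqP.
rewrite [u]row_sum_delta; elim/big_ind: _ => // [y z fy fz|k _].
  by have := fl 1 y z; rewrite scale1r fy fz mulr0 addr0.
by have := fl (u 0 k) (delta_mx 0 k) 0; rewrite f0 f00 mulr0 !addr0.
Qed.

Lemma phi_form_eq0 J c x : differentiable J x -> differentiable c x ->
  (forall u v w, phi_form J c x u v w = 0) <->
  (forall k a b, phi J c k a b x = 0).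
Proof.
move=> dJ dc; have dJc := differentiable_mulmx dJ dc; split=> [H k a b|H u v w].
  by rewrite -phi_form_delta.
have ringE (r a a' b b' d d' e e' : R) :
    r * a + a' - (r * b + b') + (r * d + d') + (r * e + e') =
    r * (a - b + d + e) + (a' - b' + d' + e') by ring.
move: w; apply: linear_form_eq0 => [r w w'|b].
  rewrite /phi_form (derive_dirP r w w' dJ) [(_ + _)^T]linearP /= mulmxDr.
  by rewrite -scalemxAr !formPr formPm ringE.
move: v; apply: linear_form_eq0 => [r v v'|a].
  rewrite /phi_form (derive_dirP r v v' dJ) mulmxDl.
  by rewrite -scalemxAl !formPl formPm ringE.
move: u; apply: linear_form_eq0 => [r u u'|k]; last by rewrite phi_form_delta.
rewrite /phi_form (derive_dirP r u u' dJc) mulmxDl -scalemxAl.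
by rewrite (derive_dirP r _ _ dc) !formPm formPl formPr ringE.
Qed.

End TachibanaPointwise.

(** * Parallel complex structures and the Tachibana operator *)

(** Write [N] for the covariant derivative of [J] with its last index lowered
    by [g].  As the connection is torsion free, every partial derivative in the
    Tachibana operator may be replaced by a covariant one, and the derivatives
    of [g] disappear:
    [phi k a b = - N k a b + N a k b + N b k a].  Purity makes [N] symmetric in
    its last two indices, so that [2 N k a b = phi a b k + phi b a k]. *)
Section NablaAlgebra.
Context {R : realFieldType} {n : nat}.
Variables (J g h : 'M[R]_n) (dg dJ : 'I_n -> 'I_n -> 'I_n -> R).
Hypothesis gs : forall a b, g a b = g b a.
Hypothesis hg : forall a b, \sum_s g a s * h s b = (a == b)%:R.
Hypothesis dgs : forall k a b, dg k a b = dg k b a.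
Hypothesis Jgs : forall a b, \sum_s J a s * g s b = \sum_s J b s * g s a.
Let P k a b := \sum_s dJ k a s * g s b.
Let B k a b := \sum_s J a s * dg k s b.
Let A k a b := \sum_s J k s * dg s a b.
Hypothesis dJgs : forall k a b, P k a b + B k a b = P k b a + B k b a.

Let Gam (a b m : 'I_n) : R :=
  2^-1 * \sum_l h m l * (dg a l b + dg b l a - dg l a b).
Let nab (k a b : 'I_n) : R :=
  dJ k a b + \sum_s Gam k s b * J a s - \sum_s Gam k a s * J s b.
Let N k a c := \sum_b nab k a b * g b c.
Let ph k a b := A k a b - (P k a b + B k a b) + P a k b + \sum_m dJ b k m * g a m.

Let Gam_low a b c : \sum_m Gam a b m * g m c = 2^-1 * (dg a c b + dg b c a - dg c a b).
Proof.
under eq_bigr do rewrite /Gam -mulrA mulr_suml; rewrite -mulr_sumr; congr (_ * _).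
rewrite exchange_big /=.
under eq_bigr => l _.
  rewrite (_ : \sum_m _ = (c == l)%:R * (dg a l b + dg b l a - dg l a b)); last first.
    by rewrite -hg mulr_suml; apply: eq_bigr => m _; rewrite (gs m c); ring.
  over.
rewrite (bigD1 c) //= eqxx mul1r big1 ?addr0 // => l lc.
by rewrite eq_sym (negbTE lc) mul0r.
Qed.

Let N_E k a c : 2 * N k a c =
  2 * P k a c + (B k a c + A a k c - B c a k) - (B k c a + B a c k - A c k a).
Proof.
have E1 : \sum_b (\sum_s Gam k s b * J a s) * g b c =
          2^-1 * (B k a c + A a k c - B c a k).
  under eq_bigr do rewrite mulr_suml. rewrite exchange_big /=.
  rewrite /B /A -sumrN -!big_split mulr_sumr; apply: eq_bigr => s _ /=.
  rewrite (dgs k s c) (dgs s k c) (dgs c s k) -!mulrDr -mulrBr mulrCA -Gam_low mulr_sumr.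
  by apply: eq_bigr => b _; rewrite mulrAC mulrC.
have E2 : \sum_b (\sum_s Gam k a s * J s b) * g b c =
          2^-1 * (B k c a + B a c k - A c k a).
  under eq_bigr do rewrite mulr_suml. rewrite exchange_big /=.
  under eq_bigr do (under eq_bigr do rewrite -mulrA; rewrite -mulr_sumr Jgs mulr_sumr).
  rewrite exchange_big /=.
  rewrite /B /A -sumrN -!big_split mulr_sumr; apply: eq_bigr => m _ /=.
  rewrite -mulrN -!mulrDr mulrCA -Gam_low mulr_sumr.
  by apply: eq_bigr => b _; rewrite mulrCA (gs m b).
rewrite /N; under eq_bigr do rewrite /nab mulrBl mulrDl.
rewrite sumrB big_split /= E1 E2 -/(P k a c).
by rewrite mulrBr mulrDr !mulrA divff ?pnatr_eq0 // !mul1r.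
Qed.

Let P_E k a b : \sum_m dJ b k m * g a m = P b k a.
Proof. by apply: eq_bigr => m _; rewrite gs. Qed.

Let A_sym k a b : A k a b = A k b a.
Proof. by apply: eq_bigr => s _; rewrite dgs. Qed.

Let nabla_of_phi k a c : 2 * N k a c = ph a c k + ph c a k.
Proof.
rewrite N_E /ph !P_E; have := dJgs k a c; have := A_sym a k c; have := A_sym c k a.
by move: (P k a c) (P k c a) (B k a c) (B k c a) (A a k c) (A c k a) (A a c k)
  (A c a k) (B c a k) (B a c k) (P c a k) (P a c k) => *; lra.
Qed.

Let phi_of_nabla k a b : 2 * ph k a b = 2 * (- N k a b + N a k b + N b k a).
Proof.
rewrite [RHS]mulrDr [X in _ = X + _]mulrDr mulrN !N_E /ph !P_E.
have := dJgs k a b; have := dJgs a k b; have := dJgs b k a.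
have := A_sym k a b; have := A_sym a k b; have := A_sym b k a.
move: (P k a b) (P k b a) (P a k b) (P a b k) (P b k a) (P b a k)
  (B k a b) (B k b a) (B a k b) (B a b k) (B b k a) (B b a k)
  (A k a b) (A k b a) (A a k b) (A a b k) (A b k a) (A b a k) => *; lra.
Qed.

Lemma nabla_phi_algebra :
  (forall k a b, nab k a b = 0) <-> (forall k a b, ph k a b = 0).
Proof.
have two : (2 : R) != 0 by rewrite pnatr_eq0.
split=> [n0 k a b|p0 k a b].
  have N0 k' a' b' : N k' a' b' = 0 by apply: big1 => s _; rewrite n0 mul0r.
  by apply: (mulfI two); rewrite phi_of_nabla !N0 oppr0 !addr0.
have N0 c : N k a c = 0.
  by apply: (mulfI two); rewrite nabla_of_phi !p0 addr0 mulr0.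
have -> : nab k a b = \sum_c N k a c * h c b.
  under eq_bigr do rewrite mulr_suml.
  rewrite exchange_big /= (eq_bigr (fun j => nab k a j * (j == b)%:R)); last first.
    by move=> j _; rewrite -hg mulr_sumr; apply: eq_bigr => i _; rewrite mulrA.
  rewrite (bigD1 b) //= eqxx mulr1 big1 ?addr0 // => j jb.
  by rewrite (negbTE jb) mulr0.
by apply: big1 => c _; rewrite N0 mul0r.
Qed.

End NablaAlgebra.

Section NablaPhi.
Context {R : realType} {n : nat} (M : charted R n).

(** The hypotheses hold near [x] because the derivatives of the symmetry and of
    the purity of [g] are used as well. *)
Lemma nabla_phi (J g : mcomp M) i x :
  differentiable (J i) x -> differentiable (g i) x -> g i x \in unitmx ->
  (\forall u \near x, (g i u)^T = g i u) ->
  (\forall u \near x, J i u *m g i u = g i u *m (J i u)^T) ->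
  (forall k a b, nabla11 g J i k a b x = 0) <->
  (forall k a b, phi (J i) (g i) k a b x = 0).
Proof.
move=> dJ dg gu gs Jgs.
have /differentiable_mx dJE := dJ; have /differentiable_mx dgE := dg.
have JgC : \forall u \near x, (J i u *m g i u)^T = J i u *m g i u.
  near=> u; rewrite trmx_mul.
  have -> : (g i u)^T = g i u by near: u.
  by apply/esym; near: u.
have gsx a b : g i x a b = g i x b a.
  by rewrite -[in LHS](nbhs_singleton gs) mxE.
have hg a b : \sum_s g i x a s * invmx (g i x) s b = (a == b)%:R.
  by have /matrixP/(_ a b) := mulmxV gu; rewrite !mxE.
have dgs k a b : partial k (fun u => g i u a b) x = partial k (fun u => g i u b a) x.
  apply: near_eq_derive; apply: filterS gs => u gsu.
  by rewrite -[in LHS]gsu mxE.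
have Jgsx a b : \sum_s J i x a s * g i x s b = \sum_s J i x b s * g i x s a.
  by have /matrixP/(_ b a) := nbhs_singleton JgC; rewrite !mxE.
pose dgm k a b := partial k (fun u => g i u a b) x.
pose dJm k a b := partial k (fun u => J i u a b) x.
have dP k a b : partial k (fun u => (J i u *m g i u) a b) x =
    \sum_s dJm k a s * g i x s b + \sum_s J i x a s * dgm k s b.
  rewrite /partial -derive_mxE; last exact: differentiable_mulmx.
  rewrite derive_mulmx // mxE [X in X + _]mxE [X in _ + X]mxE.
  by congr (_ + _); apply: eq_bigr => s _; rewrite derive_mxE.
have dJgs k a b : \sum_s dJm k a s * g i x s b + \sum_s J i x a s * dgm k s b =
    \sum_s dJm k b s * g i x s a + \sum_s J i x b s * dgm k s a.
  rewrite -!dP; apply: near_eq_derive; apply: filterS JgC => u JgCu.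
  by rewrite -[in LHS]JgCu mxE.
have [n_p p_n] := nabla_phi_algebra gsx hg dgs Jgsx dJgs.
split=> [H k a b|H k a b].
  by rewrite /phi dP; apply: n_p.
by apply: p_n => k' a' b'; have := H k' a' b'; rewrite /phi dP.
Unshelve. all: by end_near. Qed.

End NablaPhi.

(** * Tensoriality of the Tachibana operator *)

Section TachibanaForm.
Context {R : realType} {n : nat} (M : charted R n).

Lemma form_tr (v w : 'rV[R]_n) C : form v C w = form w C^T v.
Proof.
rewrite /form -[in LHS](trmxK (_ *m w^T)) mxE.
by rewrite !trmx_mul trmxK mulmxA.
Qed.

Let form_expl (w y z t : 'rV[R]_n) (A B C : 'M[R]_n) :
  form (y *m A + (z *m B - t)) C w =
  form y (A *m C) w + form z (B *m C) w - form t C w.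
Proof.
rewrite /form !mulmxDl !mulNmx mxE [X in _ + X]mxE [X in _ + (_ + X)]mxE.
by rewrite addrA !mulmxA.
Qed.

Let form_expr (v y z t : 'rV[R]_n) (A B C : 'M[R]_n) :
  form v C (y *m A + (z *m B - t)) =
  form v (C *m A^T) y + form v (C *m B^T) z - form v C t.
Proof. by rewrite form_tr form_expl ![form _ _ v]form_tr !trmx_mul !trmxK. Qed.

(** For arbitrary fields the derivatives of [X], [Y] and [Z] cancel, so that
    the Tachibana operator of a pure tensor is a tensor. *)
Lemma tachibanaE (J c : mcomp M) (X Y Z : vcomp M) i x :
  differentiable (J i) x -> differentiable (c i) x ->
  differentiable (X i) x -> differentiable (Y i) x -> differentiable (Z i) x ->
  J i x *m c i x = c i x *m (J i x)^T ->
  tachibana J c X Y Z i x = phi_form (J i) (c i) x (X i x) (Y i x) (Z i x).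
Proof.
move=> dJ dc dX dY dZ Jc.
have dZT : differentiable (fun u => (Z i u)^T) x := differentiable_trmx dZ.
have dJc := differentiable_mulmx dJ dc.
have dXJ := differentiable_mulmx dX dJ.
have dZJ := differentiable_mulmx dZ dJ.
have dYJ := differentiable_mulmx dY dJ.
have dYc := differentiable_mulmx dY dc.
have dYJc := differentiable_mulmx dY dJc.
have dYcZ := differentiable_mulmx dYc dZT.
have dYJcZ := differentiable_mulmx dYJc dZT.
have evE w : lift1 (Defs.eval c Y Z i) x w =
    form ('D_w (Y i) x) (c i x) (Z i x) + form (Y i x) ('D_w (c i) x) (Z i x)
    + form (Y i x) (c i x) ('D_w (Z i) x).
  have /differentiable_mx dE := dYcZ.
  rewrite lift1E; last exact: dE.
  rewrite -(derive_mxE _ 0 0 dYcZ) (derive_mulmx w dYc dZT) (derive_mulmx w dY dc).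
  by rewrite (derive_trmx w dZ) /form mulmxDl mxE [X in X + _]mxE.
have evJE w : lift1 (Defs.eval c (app J Y) Z i) x w =
    form ('D_w (Y i) x) (J i x *m c i x) (Z i x)
    + form (Y i x) ('D_w (fun p => J i p *m c i p) x) (Z i x)
    + form (Y i x) (J i x *m c i x) ('D_w (Z i) x).
  have -> : Defs.eval c (app J Y) Z i = (fun u => (Y i u *m (J i u *m c i u) *m (Z i u)^T) 0 0).
    by apply/funext => u; rewrite /Defs.eval /app !mulmxA.
  have /differentiable_mx dE := dYJcZ.
  rewrite lift1E; last exact: dE.
  rewrite -(derive_mxE _ 0 0 dYJcZ) (derive_mulmx w dYJc dZT) (derive_mulmx w dY dJc).
  by rewrite (derive_trmx w dZ) /form mulmxDl mxE [X in X + _]mxE.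
have regroup (p q r s : 'rV[R]_n) : p + q - r - (p - s) = q + (s - r).
  by apply/rowP => j; rewrite !mxE; ring.
have lieE (W : vcomp M) : differentiable (W i) x ->
    lie11 W J X i x = X i x *m 'D_(W i x) (J i) x
      + ('D_(X i x) (W i) x *m J i x - 'D_(X i x *m J i x) (W i) x).
  move=> dW; rewrite /lie11 /bracket /app !(lift1E _ dW) (lift1E _ dX) (lift1E _ dXJ).
  rewrite (derive_mulmx _ dX dJ) mulmxBl.
  exact: regroup.
rewrite /tachibana evE evJE /Defs.eval !lieE // /app /phi_form -!/(form _ _ _).
rewrite form_expl form_expr -Jc.
have regroup_scalar (e1 e2 e3 f1 f2 f3 p s : R) :
    e1 + e2 + e3 - (f1 + f2 + f3) + (p + f1 - e1) + (s + f3 - e3) =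
    e2 - f2 + p + s by ring.
exact: regroup_scalar.
Qed.

End TachibanaForm.

(** * Charts and changes of coordinates *)

Section Jacobian.
Context {R : realType} {n : nat}.

Lemma open_preimage (V W : normedModType R) (A : set V) (B : set W) (f : V -> W) :
  open A -> (forall x, A x -> differentiable f x) -> open B ->
  open (A `&` f @^-1` B).
Proof.
move=> oA df oB; rewrite openE => x [Ax Bfx]; rewrite /interior.
apply: filterI; first exact: open_nbhs_nbhs.
have /differentiable_continuous := df x Ax; apply.
exact: open_nbhs_nbhs.
Qed.

Lemma jacobianE m (f : 'rV[R]_n -> 'rV[R]_m) x a b :
  differentiable f x -> 'J f x a b = partial a (fun u => f u 0 b) x.
Proof.
move=> df; rewrite /jacobian mxE -deriveE //.
by rewrite derive_mxE.
Qed.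

Lemma row_jacobian m (f : 'rV[R]_n -> 'rV[R]_m) x a :
  differentiable f x -> row a ('J f x) = 'D_(delta_mx 0 a) f x.
Proof. by move=> df; rewrite rowE (deriveEjacobian _ df). Qed.

Lemma jacobian_comp m p (f : 'rV[R]_n -> 'rV[R]_m) (g : 'rV[R]_m -> 'rV[R]_p) x :
  differentiable f x -> differentiable g (f x) ->
  'J (fun u => g (f u)) x = 'J f x *m 'J g (f x).
Proof.
move=> df dg; apply/row_matrixP => a.
have dgf : differentiable (g \o f) x by exact: differentiable_comp.
rewrite (row_jacobian a dgf) row_mul (row_jacobian a df).
rewrite -(deriveEjacobian _ dg) (deriveE _ dgf) (diff_comp df dg) /=.
by rewrite (deriveE _ dg) (deriveE _ df).
Qed.

Lemma near_eq_jacobian m (f g : 'rV[R]_n -> 'rV[R]_m) x :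
  (\forall u \near x, f u = g u) -> differentiable f x -> 'J f x = 'J g x.
Proof.
move=> fg df; have dg := near_eq_differentiable fg df.
apply/row_matrixP => a.
apply: etrans (row_jacobian a df) _; apply: etrans _ (esym (row_jacobian a dg)).
exact: near_eq_derive.
Qed.

Lemma jacobian_id x : 'J (fun u : 'rV[R]_n => u) x = 1%:M.
Proof.
have did : differentiable (fun u : 'rV[R]_n => u) x.
  by apply: smooth_diff (@id_smooth _ _ setT) _.
apply/row_matrixP => a; rewrite (row_jacobian a did) rowE mulmx1.
exact: derive_id.
Qed.

End Jacobian.

Section Charts.
Context {R : realType} {n : nat} (M : charted R n).
Hypothesis mM : is_manifold M.

Lemma chart_inj i (p q : M) : chart_dom i p -> chart_dom i q ->
  chart_map i p = chart_map i q -> p = q.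
Proof. by case: mM => H _ _ _ _; apply: H. Qed.

Lemma open_overlap (i j : idx M) : open (overlap i j).
Proof. by case: mM => _ H _ _ _; apply: H. Qed.

Lemma smooth_transition (i j : idx M) : smooth_on (overlap i j) (transition i j).
Proof. by case: mM => _ _ H _ _; apply: H. Qed.

Lemma chart_image_overlap (i : idx M) : chart_image i = overlap i i.
Proof. by rewrite /chart_image /overlap setIid. Qed.

Lemma open_chart_image (i : idx M) : open (chart_image i).
Proof. by rewrite chart_image_overlap; exact: open_overlap. Qed.

Lemma overlap_chart_image (i j : idx M) x : overlap i j x -> chart_image i x.
Proof. by case=> p [pi _] <-; exists p. Qed.

Lemma overlap_in (i j : idx M) p :
  chart_dom i p -> chart_dom j p -> overlap i j (chart_map i p).
Proof. by move=> pi pj; exists p. Qed.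

Lemma overlapP (i j : idx M) p :
  chart_dom i p -> overlap i j (chart_map i p) -> chart_dom j p.
Proof. by move=> pi [q [qi qj] qp]; rewrite -(chart_inj qi pi qp). Qed.

Lemma transitionE (i j : idx M) p : chart_dom i p -> chart_dom j p ->
  transition i j (chart_map i p) = chart_map j p.
Proof.
move=> pi pj; rewrite /transition; case: xgetP => [y _ [q [qi qj qp <-]]|].
  by rewrite (chart_inj qi pi qp).
by move=> /(_ (chart_map j p)); case; exists p.
Qed.

Lemma transition_overlap (i j : idx M) x :
  overlap i j x -> overlap j i (transition i j x).
Proof. by case=> p [pi pj] <-; rewrite transitionE //; exact: overlap_in. Qed.

Lemma transition_diff i j x : overlap i j x -> differentiable (@transition R n M i j) x.
Proof. by move=> ox; exact: (smooth_diff (@smooth_transition i j) ox). Qed.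

Lemma jacobian_self i x : chart_image i x -> 'J (@transition R n M i i) x = 1%:M.
Proof.
move=> cx; have ox : overlap i i x by rewrite -chart_image_overlap.
rewrite (@near_eq_jacobian _ _ _ _ (fun u => u)) ?jacobian_id //; last exact: transition_diff.
apply: (open_near (@open_chart_image i)) => // u [p pi <-].
by rewrite transitionE.
Qed.

(** This makes the extension of a field from one chart to the others obey the
    transformation law. *)
Lemma jacobian_cocycle (i j k : idx M) p :
  chart_dom i p -> chart_dom j p -> chart_dom k p ->
  'J (@transition R n M i k) (chart_map i p) =
  'J (@transition R n M i j) (chart_map i p) *m 'J (@transition R n M j k) (chart_map j p).
Proof.
move=> pi pj pk; have oij := overlap_in pi pj; have ojk := overlap_in pj pk.
rewrite -(transitionE pi pj) -jacobian_comp; last 2 first.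
- exact: transition_diff.
- by rewrite transitionE //; exact: transition_diff.
apply: near_eq_jacobian; last by apply/transition_diff/overlap_in.
have oA : open (overlap i j `&` @transition R n M i j @^-1` (overlap j k)).
  apply: open_preimage (@open_overlap i j) _ (@open_overlap j k) => x.
  exact: transition_diff.
apply: (open_near oA); first by split=> //=; rewrite transitionE.
move=> u [[q [qi qj] <-]]; rewrite /= transitionE // => /(overlapP qj) qk.
by rewrite !transitionE.
Qed.

End Charts.

Arguments open_overlap {R n M} mM i j.
Arguments open_chart_image {R n M} mM i.
Arguments smooth_transition {R n M} mM i j.
Arguments transition_diff {R n M} mM {i j x}.

(** * Vector fields with prescribed values *)

Section BumpSpace.
Context {R : realType} {n : nat}.

(** A plateau function of the squared Euclidean norm, rescaled so that its
    support lies in [U]. *)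
Lemma smooth_bump (U : set 'rV[R]_n) (x0 : 'rV[R]_n) : open U -> U x0 ->
  exists (b : 'rV[R]_n -> R) (K : set 'rV[R]_n),
    [/\ smooth_on setT b, (\forall u \near x0, b u = 1), compact K, K `<=` U &
        forall u, ~ K u -> b u = 0].
Proof.
move=> oU Ux0.
have [e /= e0 He] := (nbhs_ballP _ _).1 (open_nbhs_nbhs (conj oU Ux0)).
pose d := e / 4; have d0 : 0 < d by rewrite divr_gt0.
pose rho (u : 'rV[R]_n) := \sum_s (((u 0 s - x0 0 s) / d) * ((u 0 s - x0 0 s) / d)).
have oT : open [set: 'rV[R]_n] by exact: openT.
have s_rho : smooth_on setT rho.
  apply: (smooth_sum _ _ oT) => s.
  have s1 : smooth_on setT (fun u : 'rV[R]_n => (u 0 s - x0 0 s) / d).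
    apply: smooth_mul => //; last exact: smooth_cst.
    by apply: smooth_add => //; [exact: coord_smooth|exact: smooth_cst].
  exact: smooth_mul.
pose K : set 'rV[R]_n := [set u | `|u - x0| <= 2 * d].
exists (fun u => plateau (rho u)), K; split.
- by apply: (smooth_comp_real (B := setT)) => //; exact: smooth_plateau.
- have c_rho : {for x0, continuous rho} by exact: smooth_continuous s_rho _.
  have rho0 : rho x0 = 0.
    by apply: big1 => s _; rewrite subrr mul0r mul0r.
  have : \forall u \near x0, `|rho x0 - rho u| < 1.
    by move/cvgrPdist_lt : c_rho; apply.
  apply: filterS => u; rewrite rho0 sub0r normrN => ru.
  by apply: plateau1; apply: ltW; apply: le_lt_trans ru; exact: ler_norm.
- apply: bounded_closed_compact.
    exists (`|x0| + 2 * d); split; first exact: num_real.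
    move=> M' HM u Ku; apply: ltW; apply: le_lt_trans HM.
    rewrite -(subrK x0 u) addrC (le_trans (ler_normD _ _)) // lerD //.
  have -> : K = (fun u : 'rV[R]_n => `|u - x0|) @^-1` [set r | r <= 2 * d] by [].
  apply: closed_comp; last exact: closed_le.
  move=> u _; apply: continuous_comp; last exact: norm_continuous.
  by apply: continuousB; [exact: cvg_id|exact: cst_continuous].
- move=> u Ku; apply: He; rewrite -ball_normE /= distrC (le_lt_trans Ku) //.
  by rewrite /d; lra.
(* A coordinate of size over 2 d alone makes rho exceed 2. *)
- move=> u nKu; apply: plateau0; rewrite leNgt; apply/negP => r2; apply: nKu.
  rewrite /K /= /Num.Def.normr /= mx_normrE; apply: bigmax_le.
    by rewrite mulr_ge0 // ltW.
  move=> [k s] _ /=; rewrite !mxE ord1.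
  have : (u 0 s - x0 0 s) / d * ((u 0 s - x0 0 s) / d) <= 2.
    apply: le_trans (ltW r2); rewrite /rho (bigD1 s) //= lerDl.
    by apply: sumr_ge0 => k' _; rewrite -expr2 sqr_ge0.
  rewrite -expr2 => H.
  have : `|(u 0 s - x0 0 s) / d| <= 2.
    rewrite -[leRHS]ger0_norm // -ler_sqr ?nnegrE // !real_normK ?num_real //.
    by apply: (le_trans H); rewrite expr2; lra.
  by rewrite normrM normfV (gtr0_norm d0) ler_pdivrMr.
Qed.

End BumpSpace.

Section BumpFields.
Context {R : realType} {n : nat} (M : charted R n).
Hypothesis mM : is_manifold M.

(** This is where the Hausdorff property is used: without it, extending by
    zero a field with compact support in one chart need not be smooth. *)
Lemma compact_chart_separation (i j : idx M) (K : set 'rV[R]_n) (p : M) :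
  compact K -> K `<=` chart_image i -> chart_dom j p -> ~ chart_dom i p ->
  \forall y \near chart_map j p, forall u, K u ->
    ~ exists q : M, [/\ chart_dom j q, chart_dom i q, chart_map j q = y & chart_map i q = u].
Proof.
move=> cK KU pj npi.
have := (compact_near_coveringP K).1 cK _ (nbhs (chart_map j p))
  (fun y u => ~ exists q : M, [/\ chart_dom j q, chart_dom i q, chart_map j q = y
                                & chart_map i q = u]).
apply => u Ku; have [q0 q0i q0u] := KU _ Ku.
have pq : p <> q0 by move=> pq; apply: npi; rewrite pq.
have [_ _ _ _ /(_ _ _ pq)[A [B [oA oB Ap Bq AB]]]] := mM.
exists (chart_map i @` (B `&` chart_dom i), chart_map j @` (A `&` chart_dom j)) => /=.
  split; apply: open_nbhs_nbhs; split; first exact: oB.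
  - by exists q0.
  - exact: oA.
  - by exists p.
move=> [u' y'] /= [[q2 [Bq2 q2i] q2u] [q1 [Aq1 q1j] q1y]] [q [qj qi qy qu]].
have qq1 : q = q1 by apply: (chart_inj mM qj q1j); rewrite qy.
have qq2 : q = q2 by apply: (chart_inj mM qi q2i); rewrite qu.
have : (A `&` B) q by split; [rewrite qq1|rewrite qq2].
by rewrite AB.
Qed.

Lemma smooth_jacobian (i j : idx M) :
  smooth_on (overlap i j) (jacobian (@transition R n M i j)).
Proof.
have oO := open_overlap mM i j.
apply/smooth_mx => // a b.
have /smooth_mx st := smooth_transition mM i j.
apply: (smooth_ext oO (f := partial a (fun u => transition i j u 0 b))).
  by move=> x ox; rewrite jacobianE //; exact: (transition_diff mM ox).
by apply: smooth_derive; exact: st.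
Qed.

(** The tests with vector fields in the definitions can be done with fields
    that are constant near a given point of a chart. *)
Lemma local_constant_field (i : idx M) x0 (v : 'rV[R]_n) : chart_image i x0 ->
  exists2 X : vcomp M, vector_field X & \forall u \near x0, X i u = v.
Proof.
move=> cx0; have oi := open_chart_image mM i.
have [b [K [sb b1 cK KU b0]]] := smooth_bump oi cx0.
pose Y (j : idx M) y := b (transition j i y) *:
  (v *m 'J (@transition R n M i j) (transition j i y)).
pose X : vcomp M := fun j y => if `[< overlap j i y >] then Y j y else 0.
have XE j y : overlap j i y -> X j y = Y j y.
  by move=> oy; rewrite /X asboolT.
have X0 j y : ~ overlap j i y -> X j y = 0.
  by move=> oy; rewrite /X asboolF.
have Yi x : chart_image i x -> Y i x = b x *: v.
  move=> cx; rewrite /Y; have -> : transition i i x = x.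
    by case: cx => p pi <-; rewrite transitionE.
  by rewrite jacobian_self // mulmx1.
exists X; last first.
  near=> u; have cu : chart_image i u by near: u; apply: open_nbhs_nbhs.
  rewrite XE -?chart_image_overlap // Yi //.
  have -> : b u = 1 by near: u.
  by rewrite scale1r.
have sY j : smooth_on (overlap j i) (Y j).
  have oO := open_overlap mM j i.
  have sji := smooth_transition mM j i.
  have sb' : smooth_on (overlap j i) (fun y => b (transition j i y)).
    exact: (smooth_comp_row_scalar oO (B := setT) _ sb sji).
  have sJ : smooth_on (overlap j i)
      (fun y => 'J (@transition R n M i j) (transition j i y)).
    apply: (smooth_comp_row oO (open_overlap mM i j) _ (@smooth_jacobian i j) sji).
    exact: transition_overlap.
  apply/smooth_mx => // a c.
  apply: (smooth_ext oO (f := fun y => b (transition j i y) *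
     \sum_s v a s * 'J (@transition R n M i j) (transition j i y) s c)).
    by move=> y _; rewrite !mxE.
  apply: smooth_mul => //; apply: smooth_sum => // s.
  apply: smooth_mul => //; first exact: smooth_cst.
  by have /smooth_mx := sJ; apply.
split=> [j|j k x [p [pj pk] <-]].
  apply: smooth_local => y [p pj <-]; case: (pselect (chart_dom i p)) => pi.
    exists (overlap j i); first exact: overlap_in.
    apply: (smooth_ext (open_overlap mM j i) _ (@sY j)) => y' oy'.
    by rewrite XE.
  pose S : set 'rV[R]_n := [set y | forall u, K u -> ~ exists q : M,
    [/\ chart_dom j q, chart_dom i q, chart_map j q = y & chart_map i q = u]].
  have nS : nbhs (chart_map j p) S := compact_chart_separation cK KU pj pi.
  exists (interior S) => //.
  apply: (smooth_ext (open_interior S) (f := fun=> 0)); last exact: smooth_cst.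
  move=> y' /interior_subset Sy'; case: (pselect (overlap j i y')) => oy'; last first.
    by rewrite X0.
  rewrite XE // /Y b0 ?scale0r // => Ky'.
  case: (oy') => q [qj qi] qy'; apply: (Sy' _ Ky'); exists q; split=> //.
  by rewrite -qy' transitionE.
rewrite transitionE //; case: (pselect (chart_dom i p)) => pi; last first.
  rewrite X0; last by move=> /(overlapP mM pk).
  by rewrite X0 ?mul0mx // => /(overlapP mM pj).
rewrite !XE; try exact: overlap_in.
rewrite /Y !transitionE // -scalemxAl -mulmxA.
by rewrite -jacobian_cocycle.
Unshelve. all: by end_near. Qed.

End BumpFields.

(** * Holomorphic and anti-Kaehler metrics in components *)

Section Characterizations.
Context {R : realType} {n : nat} (M : charted R n).
Hypothesis mM : is_manifold M.

(** Purity is tensorial, so fields with prescribed values at one point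
    suffice. *)
Lemma pureP (J c : mcomp M) : pure J c <->
  (forall i x, chart_image i x -> J i x *m c i x = c i x *m (J i x)^T).
Proof.
split=> [pJc i x cx|H X Y _ _ i x cx]; last first.
  rewrite /Defs.eval /app -[_ *m J i x *m c i x]mulmxA H // trmx_mul.
  by rewrite !mulmxA.
apply/matrixP => a b.
have [X vX nX] := local_constant_field mM (delta_mx 0 a) cx.
have [Y vY nY] := local_constant_field mM (delta_mx 0 b) cx.
have := pJc X Y vX vY i x cx.
rewrite /Defs.eval /app (nbhs_singleton nX) (nbhs_singleton nY) trmx_mul.
rewrite -[_ *m J i x *m c i x]mulmxA bilin_delta => ->.
by rewrite !mulmxA -[_ *m c i x *m (J i x)^T]mulmxA bilin_delta.
Qed.

Lemma holomorphicP (J c : mcomp M) :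
  (forall i, smooth_on (chart_image i) (J i)) ->
  (forall i, smooth_on (chart_image i) (c i)) ->
  holomorphic J c <->
  (forall i x, chart_image i x -> J i x *m c i x = c i x *m (J i x)^T) /\
  (forall i k a b x, chart_image i x -> phi (J i) (c i) k a b x = 0).
Proof.
move=> sJ sc.
have dJ i x : chart_image i x -> differentiable (J i) x.
  exact: (smooth_diff (@sJ i)).
have dc i x : chart_image i x -> differentiable (c i) x.
  exact: (smooth_diff (@sc i)).
rewrite /holomorphic pureP; split=> -[pJc H]; split=> //.
- move=> i k a b x cx; move: k a b.
  apply/phi_form_eq0; [exact: dJ|exact: dc|] => u v w.
  have [X vX nX] := local_constant_field mM u cx.
  have [Y vY nY] := local_constant_field mM v cx.
  have [Z vZ nZ] := local_constant_field mM w cx.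
  have dV W : vector_field W -> differentiable (W i) x.
    by case=> sW _; exact: (smooth_diff (@sW i)).
  have := H X Y Z vX vY vZ i x cx.
  rewrite tachibanaE; [|exact: dJ|exact: dc|exact: dV|exact: dV|exact: dV|exact: pJc].
  by rewrite (nbhs_singleton nX) (nbhs_singleton nY) (nbhs_singleton nZ).
- move=> X Y Z vX vY vZ i x cx.
  have dV W : vector_field W -> differentiable (W i) x.
    by case=> sW _; exact: (smooth_diff (@sW i)).
  rewrite tachibanaE; [|exact: dJ|exact: dc|exact: dV|exact: dV|exact: dV|exact: pJc].
  apply: (phi_form_eq0 (dJ _ _ cx) (dc _ _ cx)).2 => k a b.
  exact: H.
Qed.

(** The Levi-Civita connection disappears from the definition: an
    anti-Hermitian metric is anti-Kaehler exactly when it is holomorphic. *)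
Lemma anti_kahlerP (J g : mcomp M) :
  anti_kahler J g <->
  [/\ almost_complex J, pseudo_riemannian g,
      (forall i x, chart_image i x -> J i x *m g i x = g i x *m (J i x)^T) &
      (forall i k a b x, chart_image i x -> phi (J i) (g i) k a b x = 0)].
Proof.
have nabP : almost_complex J -> pseudo_riemannian g ->
    (forall i x, chart_image i x -> J i x *m g i x = g i x *m (J i x)^T) ->
    forall i x, chart_image i x -> (forall k a b, nabla11 g J i k a b x = 0) <->
      (forall k a b, phi (J i) (g i) k a b x = 0).
  move=> [[sJ _] _] [[[sg _] gs] gu] Jg i x cx.
  have oi := open_chart_image mM i.
  apply: nabla_phi; [exact: (smooth_diff (@sJ i))|exact: (smooth_diff (@sg i))|..].
  - exact: gu.
  - by apply: (open_near oi) => // u; exact: gs.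
  - by apply: (open_near oi) => // u; exact: Jg.
split=> [[_ aJ [pg /pureP Jg] nJ]|[aJ pg Jg pJ]].
  split=> // i k a b x cx; move: k a b; apply/nabP => // k a b; exact: nJ.
split=> //; first by split=> //; apply/pureP.
move=> i k a b x cx; move: k a b; apply/nabP => // k a b; exact: pJ.
Qed.

End Characterizations.

(** * Second-order prolongation of functions *)

(** Locked, so that unification never unfolds iterated derivatives. *)
HB.lock Definition pd (R : realType) (n : nat) (s : 'I_n) (f : 'rV[R]_n -> R) :
  'rV[R]_n -> R := partial s f.

Section PartialDerivatives.
Context {R : realType}.

Lemma pd_sum m (s : 'I_m) (I : Type) (r : seq I) (P : pred I)
    (F : I -> 'rV[R]_m -> R) x :
  (forall i, differentiable (F i) x) ->
  pd s (fun u => \sum_(i <- r | P i) F i u) x = \sum_(i <- r | P i) pd s (F i) x.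
Proof. by move=> dF; rewrite pd.unlock /partial derive_sum_scalar. Qed.

Lemma pd_mul m (s : 'I_m) (f h : 'rV[R]_m -> R) x :
  differentiable f x -> differentiable h x ->
  pd s (fun u => f u * h u) x = pd s f x * h x + f x * pd s h x.
Proof. by move=> df dh; rewrite pd.unlock /partial derive_mul_scalar. Qed.

Lemma pd_add m (s : 'I_m) (f h : 'rV[R]_m -> R) x :
  differentiable f x -> differentiable h x ->
  pd s (fun u => f u + h u) x = pd s f x + pd s h x.
Proof.
move=> df dh; rewrite pd.unlock /partial.
exact: (deriveD (diff_derivable df (v := _)) (diff_derivable dh (v := _))).
Qed.

Lemma pd_cst m (s : 'I_m) (a : R) (x : 'rV[R]_m) : pd s (fun=> a) x = 0.
Proof. by rewrite pd.unlock /partial; exact: derive_cst. Qed.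

End PartialDerivatives.

Section Prolongation.
Context {R : realType} {n : nat}.
Implicit Types (f h : 'rV[R]_n -> R) (w : 'rV[R]_(n + n + n)) (U : set 'rV[R]_n).

(** The coordinates [x], [y], [z] have weights 0, 1, 2. *)
Definition slot (k : nat) (s : 'I_n) : 'I_(n + n + n) :=
  match k with
  | 0 => lshift n (lshift n s)
  | 1 => lshift n (rshift n s)
  | _ => rshift (n + n) s
  end.

Lemma slotP (P : 'I_(n + n + n) -> Prop) :
  (forall k s, (k < 3)%N -> P (slot k s)) -> forall j, P j.
Proof.
move=> H j; case: (split_ordP j) => [j'|s] ->; last exact: (H 2%N).
by case: (split_ordP j') => s ->; [exact: (H 0%N)|exact: (H 1%N)].
Qed.

Lemma slot_eq k l s t : (k < 3)%N -> (l < 3)%N ->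
  (slot k s == slot l t) = (k == l) && (s == t).
Proof.
by case: k => [|[|[|]]] //; case: l => [|[|[|]]] // _ _ /=;
  do 2 rewrite ?(eq_lshift, eq_rshift, eq_lrshift, eq_rlshift).
Qed.

Lemma sum_slot (F : 'I_(n + n + n) -> R) :
  \sum_j F j = \sum_(k < 3) \sum_s F (slot k s).
Proof. by rewrite !big_split_ord !big_ord_recl big_ord0 addr0 /= addrA. Qed.

Lemma xpartE w s : xpart w 0 s = w 0 (slot 0 s).
Proof. by rewrite !mxE. Qed.

Lemma ypartE w s : ypart w 0 s = w 0 (slot 1 s).
Proof. by rewrite !mxE. Qed.

Lemma zpartE w s : zpart w 0 s = w 0 (slot 2 s).
Proof. by rewrite !mxE. Qed.

Definition tube U : set 'rV[R]_(n + n + n) := [set w | U (xpart w)].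

Lemma smooth_xpart (A : set 'rV[R]_(n + n + n)) : open A -> smooth_on A (@xpart R n).
Proof.
move=> oA; apply/smooth_mx => // i s; rewrite ord1.
by under eq_fun do rewrite xpartE; exact: coord_smooth.
Qed.

Lemma open_tube U : open U -> open (tube U).
Proof.
move=> oU; have oT : open [set: 'rV[R]_(n + n + n)] by exact: openT.
have := @open_preimage _ _ _ setT U (@xpart R n) oT _ oU.
rewrite setTI; apply => x _.
exact: (smooth_diff (smooth_xpart oT)).
Qed.

(** The coefficient of [e ^ k] in the Taylor expansion of [f] along
    [x + e y + e^2 z]. *)
Definition prolong (k : nat) f w : R :=
  match k with
  | 0 => f (xpart w)
  | 1 => \sum_t w 0 (slot 1 t) * pd t f (xpart w)
  | _ => \sum_t w 0 (slot 2 t) * pd t f (xpart w) +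
     2^-1 * \sum_t \sum_s (w 0 (slot 1 t) * w 0 (slot 1 s)) * pd t (pd s f) (xpart w)
  end.

Lemma prolong_lift1 f w : lift1 f (xpart w) (ypart w) = prolong 1 f w.
Proof. by apply: eq_bigr => t _; rewrite ypartE pd.unlock. Qed.

Lemma prolong_lift2 f w : lift2 f (xpart w) (ypart w) (zpart w) = prolong 2 f w.
Proof.
rewrite /lift2 /prolong pd.unlock; congr (_ + _ * _).
  by apply: eq_bigr => t _; rewrite zpartE.
by apply: eq_bigr => t _; apply: eq_bigr => s _; rewrite !ypartE.
Qed.

Lemma smooth_pd U f s : smooth_on U f -> smooth_on U (pd s f).
Proof. by rewrite pd.unlock; exact: smooth_derive. Qed.

Lemma pd_ext U s f h x : open U -> (forall x, U x -> f x = h x) -> U x ->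
  pd s f x = pd s h x.
Proof.
by move=> oU fh Ux; rewrite pd.unlock; apply: near_eq_derive; exact: (open_near oU Ux).
Qed.

Lemma prolong_ext U k f h w : open U -> (forall x, U x -> f x = h x) ->
  tube U w -> prolong k f w = prolong k h w.
Proof.
move=> oU fh Uw.
have p1 s x : U x -> pd s f x = pd s h x by apply: pd_ext.
have p2 t s : pd t (pd s f) (xpart w) = pd t (pd s h) (xpart w).
  by apply: (pd_ext t oU _ Uw) => x; exact: p1.
case: k => [|[|k]] /=; first exact: fh.
  by apply: eq_bigr => t _; rewrite (p1 t _ Uw).
congr (_ + _ * _); first by apply: eq_bigr => t _; rewrite (p1 t _ Uw).
by apply: eq_bigr => t _; apply: eq_bigr => s _; rewrite p2.
Qed.

Section OnOpen.
Variable U : set 'rV[R]_n.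
Hypothesis oU : open U.

Lemma smooth_pull f : smooth_on U f -> smooth_on (tube U) (fun w => f (xpart w)).
Proof.
move=> sf; have oT := open_tube oU.
by apply: (smooth_comp_row_scalar oT (B := U)) => //; exact: smooth_xpart.
Qed.

Lemma smooth_prolong k f : smooth_on U f -> smooth_on (tube U) (prolong k f).
Proof.
move=> sf; have oT := open_tube oU.
have s1 t : smooth_on (tube U) (fun w => pd t f (xpart w)).
  by apply: smooth_pull; apply: smooth_pd.
have s2 t s : smooth_on (tube U) (fun w => pd t (pd s f) (xpart w)).
  by apply: smooth_pull; do 2 apply: smooth_pd.
case: k => [|[|k]]; first exact: smooth_pull.
  by apply: smooth_sum => // t; apply: smooth_mul => //; exact: coord_smooth.
apply: smooth_add => //.
  by apply: smooth_sum => // t; apply: smooth_mul => //; exact: coord_smooth.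
apply: smooth_mul => //; first exact: smooth_cst.
apply: smooth_sum => // t; apply: smooth_sum => // s.
by apply: smooth_mul => //; apply: smooth_mul => //; exact: coord_smooth.
Qed.

Lemma pd_coord k l s t w : (k < 3)%N -> (l < 3)%N ->
  pd (slot k s) (fun v : 'rV[R]_(n + n + n) => v 0 (slot l t)) w =
  ((k == l) && (s == t))%:R.
Proof.
move=> k3 l3; rewrite pd.unlock /partial.
have did : differentiable (fun v : 'rV[R]_(n + n + n) => v) w.
  by apply: smooth_diff (@id_smooth _ _ setT) _.
rewrite -(derive_mxE _ 0 (slot l t) did) derive_id mxE eqxx /=.
by rewrite eq_sym slot_eq.
Qed.

Lemma pd_pull k s f w : (k < 3)%N -> differentiable f (xpart w) ->
  pd (slot k s) (fun w => f (xpart w)) w =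
  if k == 0%N then pd s f (xpart w) else 0.
Proof.
move=> k3 df; have dx : differentiable (@xpart R n) w.
  by apply: (smooth_diff (smooth_xpart openT)).
have -> : pd (slot k s) (fun w => f (xpart w)) w =
    \sum_t pd (slot k s) (fun v => v 0 (slot 0 t)) w * pd t f (xpart w).
  rewrite pd.unlock /partial (derive_comp_row _ dx df).
  by apply: eq_bigr => t _; under eq_fun do rewrite xpartE.
under eq_bigr => t _ do rewrite pd_coord //.
case: eqP => /= _; last by apply: big1 => t _; rewrite mul0r.
rewrite (bigD1 s) //= eqxx mul1r big1 ?addr0 // => t ts.
by rewrite eq_sym (negbTE ts) mul0r.
Qed.

Lemma pd_comm f x s t : smooth_on U f -> U x -> pd s (pd t f) x = pd t (pd s f) x.
Proof. by rewrite pd.unlock => sf Ux; exact: (derive_comm _ _ oU Ux sf). Qed.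

Lemma pd_comm3 f x r t s : smooth_on U f -> U x ->
  pd r (pd t (pd s f)) x = pd t (pd s (pd r f)) x.
Proof.
move=> sf Ux; rewrite pd_comm //; last exact: smooth_pd.
by apply: (pd_ext t oU _ Ux) => u Uu; exact: pd_comm.
Qed.

(** Differentiating [f (x + e y + e^2 z)] in the coordinate of weight [k] gives
    [e ^ k * (partial f) (x + e y + e^2 z)].  For the weight 1 this uses the
    symmetry of second derivatives. *)
Lemma pd_prolong k l r f w : (k < 3)%N -> (l < 3)%N -> smooth_on U f -> tube U w ->
  pd (slot k r) (prolong l f) w =
  if (k <= l)%N then prolong (l - k) (pd r f) w else 0.
Proof.
move=> k3 l3 sf Uw.
have sd t : smooth_on U (pd t f) by exact: smooth_pd.
have sdd t s : smooth_on U (pd t (pd s f)) by exact: smooth_pd.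
have sc l' t : smooth_on (tube U) (fun v : 'rV[R]_(n + n + n) => v 0 (slot l' t) : R).
  exact: coord_smooth.
have oT := open_tube oU.
have s1 l' t : smooth_on (tube U) (fun v => v 0 (slot l' t) * pd t f (xpart v)).
  by apply: smooth_mul => //; exact: smooth_pull.
have sq t s : smooth_on (tube U)
    (fun v : 'rV[R]_(n + n + n) => v 0 (slot 1 t) * v 0 (slot 1 s) : R).
  exact: smooth_mul.
have s2 t s : smooth_on (tube U)
    (fun v => (v 0 (slot 1 t) * v 0 (slot 1 s)) * pd t (pd s f) (xpart v)).
  by apply: smooth_mul => //; exact: smooth_pull.
have D (F : 'rV[R]_(n + n + n) -> R) : smooth_on (tube U) F -> differentiable F w.
  by move=> sF; exact: (smooth_diff sF).
have E1 l' t : (l' < 3)%N ->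
    pd (slot k r) (fun v => v 0 (slot l' t) * pd t f (xpart v)) w =
    ((k == l') && (r == t))%:R * pd t f (xpart w) +
    w 0 (slot l' t) * (if k == 0%N then pd r (pd t f) (xpart w) else 0).
  move=> l'3; rewrite pd_mul; [|exact: D|by apply: D; exact: smooth_pull].
  by rewrite pd_coord // pd_pull //; exact: (smooth_diff (sd t)).
have E2 t s :
    pd (slot k r) (fun v => (v 0 (slot 1 t) * v 0 (slot 1 s)) * pd t (pd s f) (xpart v)) w =
    (((k == 1%N) && (r == t))%:R * w 0 (slot 1 s) +
      w 0 (slot 1 t) * ((k == 1%N) && (r == s))%:R) * pd t (pd s f) (xpart w) +
    (w 0 (slot 1 t) * w 0 (slot 1 s)) *
      (if k == 0%N then pd r (pd t (pd s f)) (xpart w) else 0).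
  rewrite pd_mul; [|exact: D|by apply: D; exact: smooth_pull].
  rewrite pd_mul; [|exact: D|exact: D].
  by rewrite !pd_coord // pd_pull //; exact: (smooth_diff (sdd t s)).
have pick (F : 'I_n -> R) : \sum_t (r == t)%:R * F t = F r.
  rewrite (bigD1 r) //= eqxx mul1r big1 ?addr0 // => t tr.
  by rewrite eq_sym (negbTE tr) mul0r.
have S1 l' : (l' < 3)%N ->
    pd (slot k r) (fun v => \sum_t v 0 (slot l' t) * pd t f (xpart v)) w =
    (k == l')%:R * pd r f (xpart w) +
    \sum_t w 0 (slot l' t) * (if k == 0%N then pd r (pd t f) (xpart w) else 0).
  move=> l'3; rewrite pd_sum; last by move=> t; exact: D.
  under eq_bigr => t _ do rewrite (E1 l' t l'3).
  rewrite big_split /=; congr (_ + _).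
  rewrite -(pick (fun t => pd t f (xpart w))) mulr_sumr; apply: eq_bigr => t _.
  by rewrite mulrA -mulnb natrM.
case: l l3 => [|[|[|]]] // _.
- have -> : prolong 0 f = (fun w => f (xpart w)) by [].
  rewrite pd_pull //; last exact: (smooth_diff sf).
  by rewrite leqn0; case: eqP => // ->.
- have -> : prolong 1 f = (fun v => \sum_t v 0 (slot 1 t) * pd t f (xpart v)) by [].
  rewrite S1 //; case: k k3 {E1 E2 S1} => [|[|[|]]] // _ /=.
  + by rewrite mul0r add0r; apply: eq_bigr => t _; rewrite pd_comm.
  + by rewrite mul1r big1 ?addr0 // => t _; rewrite mulr0.
  + by rewrite mul0r big1 ?addr0 // => t _; rewrite mulr0.
- have -> : prolong 2 f = (fun v => \sum_t v 0 (slot 2 t) * pd t f (xpart v) +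
     2^-1 * \sum_t \sum_s (v 0 (slot 1 t) * v 0 (slot 1 s)) * pd t (pd s f) (xpart v)).
    by [].
  have sA : smooth_on (tube U) (fun v => \sum_t v 0 (slot 2 t) * pd t f (xpart v)).
    exact: smooth_sum.
  have sB t : smooth_on (tube U) (fun v =>
      \sum_s (v 0 (slot 1 t) * v 0 (slot 1 s)) * pd t (pd s f) (xpart v)).
    exact: smooth_sum.
  have sBB : smooth_on (tube U) (fun v =>
      \sum_t \sum_s (v 0 (slot 1 t) * v 0 (slot 1 s)) * pd t (pd s f) (xpart v)).
    exact: smooth_sum.
  have pdD (F G : 'rV[R]_(n + n + n) -> R) a : differentiable F w -> differentiable G w ->
      pd (slot k r) (fun v => F v + a * G v) w =
      pd (slot k r) F w + a * pd (slot k r) G w.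
    move=> dF dG; rewrite pd.unlock /partial.
    have -> : (fun v => F v + a * G v) = F + a *: G by [].
    have DF := diff_derivable dF (v := delta_mx 0 (slot k r)).
    have DG := diff_derivable dG (v := delta_mx 0 (slot k r)).
    have DaG : derivable (a *: G) w (delta_mx 0 (slot k r)) by exact: derivableZ.
    by rewrite (deriveD DF DaG) deriveZ.
  rewrite pdD; [|exact: D|exact: D].
  have S2 : pd (slot k r) (fun v => \sum_t \sum_s
      (v 0 (slot 1 t) * v 0 (slot 1 s)) * pd t (pd s f) (xpart v)) w =
      \sum_t \sum_s ((((k == 1%N) && (r == t))%:R * w 0 (slot 1 s) +
      w 0 (slot 1 t) * ((k == 1%N) && (r == s))%:R) * pd t (pd s f) (xpart w) +
    (w 0 (slot 1 t) * w 0 (slot 1 s)) *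
      (if k == 0%N then pd r (pd t (pd s f)) (xpart w) else 0)).
    rewrite pd_sum; last by move=> t; exact: D.
    apply: eq_bigr => t _; rewrite pd_sum; last by move=> s; exact: D.
    by apply: eq_bigr => s _; exact: E2.
  rewrite S1 // S2.
  case: k k3 {E1 E2 S1 S2 pdD} => [|[|[|]]] // _ /=.
  + rewrite mul0r add0r; congr (_ + _ * _).
      by apply: eq_bigr => t _; rewrite pd_comm.
    apply: eq_bigr => t _; apply: eq_bigr => s _.
    by rewrite mul0r mulr0 addr0 mul0r add0r pd_comm3.
  + rewrite mul0r add0r big1 ?add0r; last by move=> t _; rewrite mulr0.
    have -> : \sum_t \sum_s (((r == t)%:R * w 0 (slot 1 s) +
        w 0 (slot 1 t) * (r == s)%:R) * pd t (pd s f) (xpart w) +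
        w 0 (slot 1 t) * w 0 (slot 1 s) * 0) =
        2 * \sum_t w 0 (slot 1 t) * pd t (pd r f) (xpart w).
      have -> : 2 * \sum_t w 0 (slot 1 t) * pd t (pd r f) (xpart w) =
          \sum_s w 0 (slot 1 s) * pd r (pd s f) (xpart w) +
          \sum_t w 0 (slot 1 t) * pd t (pd r f) (xpart w).
        rewrite mulr2n mulrDl mul1r; congr (_ + _).
        by apply: eq_bigr => t _; rewrite (pd_comm _ _ sf).
      rewrite -(pick (fun t => \sum_s w 0 (slot 1 s) * pd t (pd s f) (xpart w))).
      rewrite -big_split /=; apply: eq_bigr => t _.
      rewrite -(pick (fun s => w 0 (slot 1 t) * pd t (pd s f) (xpart w))).
      rewrite mulr_sumr -big_split /=; apply: eq_bigr => s _; ring.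
    by rewrite mulrA mulVf ?mul1r // pnatr_eq0.
  + rewrite mul1r big1 ?addr0; last by move=> t _; rewrite mulr0.
    rewrite big1 ?mulr0 ?addr0 // => t _; apply: big1 => s _.
    by rewrite !(mul0r, mulr0, addr0).
Qed.

End OnOpen.

End Prolongation.

Arguments slot : simpl never.
Arguments prolong : simpl never.

Section ProlongationRules.
Context {R : realType} {n : nat}.
Variable U : set 'rV[R]_n.
Hypothesis oU : open U.
Implicit Types (f h : 'rV[R]_n -> R) (w : 'rV[R]_(n + n + n)).

Let Sm f := smooth_on U f.

Lemma prolong_add k f h w : (k < 3)%N -> Sm f -> Sm h -> tube U w ->
  prolong k (fun u => f u + h u) w = prolong k f w + prolong k h w.
Proof.
move=> k3 sf sh Uw.
have p1 t x : U x -> pd t (fun u => f u + h u) x = pd t f x + pd t h x.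
  by move=> Ux; rewrite pd_add //; [exact: smooth_diff sf _|exact: smooth_diff sh _].
have p2 t s : pd t (pd s (fun u => f u + h u)) (xpart w) =
    pd t (pd s f) (xpart w) + pd t (pd s h) (xpart w).
  rewrite (pd_ext t oU (fun x => p1 s x) Uw) pd_add //.
    exact: smooth_diff (smooth_pd s sf) Uw.
  exact: smooth_diff (smooth_pd s sh) Uw.
have S1 l : \sum_t w 0 (slot l t) * pd t (fun u => f u + h u) (xpart w) =
    \sum_t w 0 (slot l t) * pd t f (xpart w) + \sum_t w 0 (slot l t) * pd t h (xpart w).
  by rewrite -big_split; apply: eq_bigr => t _; rewrite (p1 t _ Uw) mulrDr.
case: k k3 => [|[|[|]]] // _; first exact: S1.
rewrite /prolong S1.
have -> : \sum_t \sum_s w 0 (slot 1 t) * w 0 (slot 1 s) *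
      pd t (pd s (fun u => f u + h u)) (xpart w) =
    \sum_t \sum_s w 0 (slot 1 t) * w 0 (slot 1 s) * pd t (pd s f) (xpart w) +
    \sum_t \sum_s w 0 (slot 1 t) * w 0 (slot 1 s) * pd t (pd s h) (xpart w).
  rewrite -big_split; apply: eq_bigr => t _; rewrite -big_split; apply: eq_bigr => s _.
  by rewrite p2 mulrDr.
by rewrite mulrDr addrACA.
Qed.

Lemma prolong_cst k a w : (k < 3)%N -> prolong k (fun=> a) w = if k == 0%N then a else 0.
Proof.
case: k => [|[|[|]]] // _; rewrite /prolong /=.
  by apply: big1 => t _; rewrite pd_cst mulr0.
rewrite big1 ?add0r; last by move=> t _; rewrite pd_cst mulr0.
rewrite big1 ?mulr0 // => t _; apply: big1 => s _.
have -> : pd s (fun=> a) = (fun=> 0) by apply/funext => u; rewrite pd_cst.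
by rewrite pd_cst mulr0.
Qed.

(** Prolongation is multiplicative modulo [e ^ 3]. *)
Lemma prolong_mul f h w : Sm f -> Sm h -> tube U w ->
  [/\ prolong 0 (fun u => f u * h u) w = prolong 0 f w * prolong 0 h w,
      prolong 1 (fun u => f u * h u) w =
        prolong 0 f w * prolong 1 h w + prolong 1 f w * prolong 0 h w &
      prolong 2 (fun u => f u * h u) w =
        prolong 0 f w * prolong 2 h w + prolong 1 f w * prolong 1 h w
        + prolong 2 f w * prolong 0 h w].
Proof.
move=> sf sh Uw; have sp g s : Sm g -> Sm (pd s g) by exact: smooth_pd.
have D g x : Sm g -> U x -> differentiable g x by move=> sg; exact: smooth_diff sg.
have p1 t x : U x -> pd t (fun u => f u * h u) x = pd t f x * h x + f x * pd t h x.
  by move=> Ux; rewrite pd_mul //; exact: D.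
have p2 t s : pd t (pd s (fun u => f u * h u)) (xpart w) =
    (pd t (pd s f) (xpart w) * h (xpart w) + pd s f (xpart w) * pd t h (xpart w)) +
    (pd t f (xpart w) * pd s h (xpart w) + f (xpart w) * pd t (pd s h) (xpart w)).
  rewrite (pd_ext t oU (fun x => p1 s x) Uw) pd_add; last 2 first.
  - by apply: differentiableM; [exact: D (sp _ s sf) _|exact: D].
  - by apply: differentiableM; [exact: D|exact: D (sp _ s sh) _].
  by rewrite !pd_mul //; try exact: D; [exact: D (sp _ s sh) _|exact: D (sp _ s sf) _].
have S1 l : \sum_t w 0 (slot l t) * pd t (fun u => f u * h u) (xpart w) =
    f (xpart w) * (\sum_t w 0 (slot l t) * pd t h (xpart w))
    + (\sum_t w 0 (slot l t) * pd t f (xpart w)) * h (xpart w).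
  rewrite mulr_sumr mulr_suml -big_split; apply: eq_bigr => t _.
  by rewrite (p1 t _ Uw) /=; ring.
split=> //; first exact: S1.
rewrite /prolong S1.
have -> : \sum_t \sum_s w 0 (slot 1 t) * w 0 (slot 1 s) *
      pd t (pd s (fun u => f u * h u)) (xpart w) =
    f (xpart w) * (\sum_t \sum_s w 0 (slot 1 t) * w 0 (slot 1 s) * pd t (pd s h) (xpart w)) +
    2 * ((\sum_t w 0 (slot 1 t) * pd t f (xpart w)) *
         (\sum_s w 0 (slot 1 s) * pd s h (xpart w))) +
    (\sum_t \sum_s w 0 (slot 1 t) * w 0 (slot 1 s) * pd t (pd s f) (xpart w)) * h (xpart w).
  have -> : forall a b : R, 2 * (a * b) = b * a + a * b by move=> a b; ring.
  rewrite !mulr_suml mulr_sumr -!big_split /=; apply: eq_bigr => t _.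
  rewrite !mulr_suml !mulr_sumr -!big_split /=; apply: eq_bigr => s _.
  by rewrite p2; ring.
set A := \sum_t \sum_s _; set B := \sum_t \sum_s _.
by move: A B => A B; field.
Qed.

Let quadratic_pull (v : 'I_n -> R) (G H : 'I_n -> 'I_n -> R) :
  \sum_t \sum_s v t * v s * (\sum_m G s m * (\sum_p G t p * H p m)) =
  \sum_p \sum_m (\sum_t v t * G t p) * (\sum_s v s * G s m) * H p m.
Proof.
transitivity (\sum_t \sum_p \sum_m v t * G t p * (\sum_s v s * G s m) * H p m).
  apply: eq_bigr => t _; rewrite [RHS]exchange_big /=.
  transitivity (\sum_m v t * (\sum_s v s * G s m) * (\sum_p G t p * H p m)).
    under [RHS]eq_bigr => m _ do rewrite -mulrA mulr_suml mulr_sumr.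
    rewrite [RHS]exchange_big /=; apply: eq_bigr => s _.
    by rewrite mulr_sumr; apply: eq_bigr => m _; rewrite !mulrA.
  apply: eq_bigr => m _; rewrite mulr_sumr; apply: eq_bigr => p _.
  by rewrite !mulrA; congr (_ * _); rewrite mulrAC.
rewrite exchange_big /=; apply: eq_bigr => p _; rewrite exchange_big /=.
by apply: eq_bigr => m _; rewrite !mulr_suml.
Qed.

Section Composition.
Variable V : set 'rV[R]_n.
Variable F : 'rV[R]_n -> 'rV[R]_n.
Hypothesis sF : smooth_on U F.
Hypothesis FV : forall x, U x -> V (F x).

(** The second-order prolongation of a map. *)
Definition tmap w : 'rV[R]_(n + n + n) :=
  row_mx (row_mx (F (xpart w)) (lift1 F (xpart w) (ypart w)))
         (lift2 F (xpart w) (ypart w) (zpart w)).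

Let sFm m : Sm (fun x => F x 0 m).
Proof. by have /smooth_mx := sF; apply. Qed.

Let partialF t m x : U x -> partial t F x 0 m = pd t (fun u => F u 0 m) x.
Proof.
by move=> Ux; rewrite pd.unlock /partial derive_mxE //; exact: smooth_diff sF Ux.
Qed.

Lemma tmap_slot k m w : (k < 3)%N -> tube U w ->
  tmap w 0 (slot k m) = prolong k (fun x => F x 0 m) w.
Proof.
move=> k3 Uw.
have p2 t s : partial t (partial s F) (xpart w) 0 m =
    pd t (pd s (fun u => F u 0 m)) (xpart w).
  have -> : partial t (partial s F) (xpart w) 0 m =
      pd t (fun u => partial s F u 0 m) (xpart w).
    rewrite pd.unlock /partial derive_mxE //.
    exact: smooth_diff (smooth_derive _ sF) Uw.
  by apply: (pd_ext t oU _ Uw) => x Ux; exact: partialF.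
case: k k3 => [|[|[|]]] // _.
- by rewrite /tmap /slot !row_mxEl.
- rewrite /tmap {1}/slot row_mxEl row_mxEr /lift1 summxE.
  by apply: eq_bigr => t _; rewrite mxE ypartE (partialF _ _ Uw).
- rewrite /tmap {1}/slot row_mxEr /lift2 mxE summxE mxE summxE; congr (_ + _ * _).
    by apply: eq_bigr => t _; rewrite mxE zpartE (partialF _ _ Uw).
  apply: eq_bigr => t _; rewrite summxE; apply: eq_bigr => s _.
  by rewrite mxE !ypartE p2.
Qed.

Lemma xpart_tmap w : xpart (tmap w) = F (xpart w).
Proof. by rewrite /xpart /tmap !row_mxKl. Qed.

Lemma pd_comp f t x : smooth_on V f -> U x ->
  pd t (fun u => f (F u)) x = \sum_m pd t (fun u => F u 0 m) x * pd m f (F x).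
Proof.
move=> sf Ux; rewrite pd.unlock /partial derive_comp_row //.
  exact: smooth_diff sF Ux.
exact: smooth_diff sf (FV Ux).
Qed.

(** Functoriality of the prolongation. *)
Lemma prolong_comp k f w : (k < 3)%N -> smooth_on V f -> tube U w ->
  prolong k (fun x => f (F x)) w = prolong k f (tmap w).
Proof.
move=> k3 sf Uw; have sp m : smooth_on V (pd m f) by exact: smooth_pd.
have D g x : Sm g -> U x -> differentiable g x by move=> sg; exact: smooth_diff sg.
have scomp m : Sm (fun u => pd m f (F u)).
  exact: (smooth_comp_row_scalar oU FV (sp m) sF).
have p2 t s : pd t (pd s (fun u => f (F u))) (xpart w) =
    \sum_m pd t (pd s (fun u => F u 0 m)) (xpart w) * pd m f (F (xpart w)) +
    \sum_m pd s (fun u => F u 0 m) (xpart w) *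
      (\sum_p pd t (fun u => F u 0 p) (xpart w) * pd p (pd m f) (F (xpart w))).
  have E x : U x -> pd s (fun u => f (F u)) x =
      \sum_m pd s (fun u => F u 0 m) x * pd m f (F x) by exact: pd_comp.
  rewrite (pd_ext t oU E Uw) pd_sum; last first.
    move=> m; apply: differentiableM; last exact: D.
    by apply: D => //; exact: (smooth_pd _ (sFm _)).
  rewrite -big_split; apply: eq_bigr => m _ /=.
  rewrite pd_mul; last 2 first.
  - by apply: D => //; exact: (smooth_pd _ (sFm _)).
  - exact: D.
  by rewrite (pd_comp _ (sp m) Uw).
case: k k3 => [|[|[|]]] // _.
- by rewrite /prolong xpart_tmap.
- rewrite /prolong xpart_tmap.
  under [in RHS]eq_bigr => m _ do rewrite tmap_slot // /prolong mulr_suml.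
  rewrite exchange_big /=; apply: eq_bigr => t _.
  rewrite (pd_comp _ sf Uw) mulr_sumr; apply: eq_bigr => m _.
  by rewrite mulrA.
- rewrite /prolong xpart_tmap.
  under [in RHS]eq_bigr => m _ do rewrite tmap_slot // /prolong mulrDl.
  rewrite big_split /= -addrA; congr (_ + _).
    under [in RHS]eq_bigr => m _ do rewrite mulr_suml.
    rewrite exchange_big /=; apply: eq_bigr => t _.
    rewrite (pd_comp _ sf Uw) mulr_sumr; apply: eq_bigr => m _.
    by rewrite mulrA.
  under [in RHS]eq_bigr => m _ do rewrite -mulrA.
  rewrite -mulr_sumr -mulrDr; congr (_ * _).
  under eq_bigr => t _ do (under eq_bigr => s _ do rewrite p2 mulrDr; rewrite big_split /=).
  rewrite big_split /=; congr (_ + _).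
    under [in RHS]eq_bigr => m _ do rewrite mulr_suml.
    rewrite [RHS]exchange_big /=; apply: eq_bigr => t _.
    under [in RHS]eq_bigr => m _ do rewrite mulr_suml.
    rewrite [RHS]exchange_big /=; apply: eq_bigr => s _.
    by rewrite mulr_sumr; apply: eq_bigr => m _; rewrite mulrA.
  rewrite quadratic_pull; apply: eq_bigr => p _; apply: eq_bigr => m _.
  by rewrite !tmap_slot.
Qed.

End Composition.

(** The coefficient of weight [q - p], which is the entry in row weight [p] and
    column weight [q] of the matrix of multiplication by the prolongation. *)
Definition lft (p q : nat) f w : R := if (p <= q)%N then prolong (q - p) f w else 0.

Lemma smooth_lft p q f : Sm f -> smooth_on (tube U) (lft p q f).
Proof.
move=> sf; rewrite /lft; case: (p <= q)%N; last exact: smooth_cst.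
exact: smooth_prolong.
Qed.

Lemma lft_ext p q f h w : (forall x, U x -> f x = h x) -> tube U w ->
  lft p q f w = lft p q h w.
Proof. by move=> fh Uw; rewrite /lft; case: ifP => // _; exact: (prolong_ext _ oU fh). Qed.

Lemma pd_lft k p q r f w : (k < 3)%N -> (q < 3)%N -> Sm f -> tube U w ->
  pd (slot k r) (lft p q f) w = lft (p + k) q (pd r f) w.
Proof.
move=> k3 q3 sf Uw; rewrite /lft; case: (leqP p q) => pq.
  rewrite (pd_prolong oU) //; last exact: leq_ltn_trans (leq_subr _ _) q3.
  by rewrite leq_subRL // subnDA.
rewrite ifF; first by rewrite pd_cst.
by apply: negbTE; rewrite -ltnNge ltn_addr.
Qed.

(** The single form of the Leibniz rule behind all products of lifts. *)
Lemma lft_mul k a q f h w : (q < 3)%N -> Sm f -> Sm h -> tube U w ->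
  \sum_(m < 3) lft k m f w * lft (m + a) q h w = lft (k + a) q (fun u => f u * h u) w.
Proof.
move=> q3 sf sh Uw; have [E0 E1 E2] := prolong_mul sf sh Uw.
rewrite !big_ord_recl big_ord0 addr0 /= /bump /=.
case: q q3 => [|[|[|]]] // _; case: k => [|[|[|k]]];
  case: a => [|[|[|a]]]; rewrite /lft /= ?subSS ?subn0 ?E0 ?E1 ?E2; try ring.
Qed.

Lemma lft_add p q f h w : (q < 3)%N -> Sm f -> Sm h -> tube U w ->
  lft p q (fun u => f u + h u) w = lft p q f w + lft p q h w.
Proof.
move=> q3 sf sh Uw; rewrite /lft; case: ifP => _; last by rewrite addr0.
by rewrite prolong_add //; exact: leq_ltn_trans (leq_subr _ _) q3.
Qed.

Lemma lft_cst p q a w : (q < 3)%N -> lft p q (fun=> a) w = if p == q then a else 0.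
Proof.
move=> q3; rewrite /lft; case: leqP => pq; last by rewrite gtn_eqF.
rewrite prolong_cst; last exact: leq_ltn_trans (leq_subr _ _) q3.
by rewrite subn_eq0 eqn_leq pq.
Qed.

Lemma lft_opp p q f w : (q < 3)%N -> Sm f -> tube U w ->
  lft p q (fun u => - f u) w = - lft p q f w.
Proof.
move=> q3 sf Uw; have sN : Sm (fun u => - f u) by exact: smooth_opp.
apply/eqP; rewrite -subr_eq0 opprK -lft_add //.
rewrite (@lft_ext _ _ _ (fun=> 0)) // => [|x _]; last by rewrite addNr.
by rewrite lft_cst //; case: ifP.
Qed.

Lemma lft_sum (I : Type) (r : seq I) p q (f : I -> 'rV[R]_n -> R) w :
  (q < 3)%N -> (forall i, Sm (f i)) -> tube U w ->
  lft p q (fun u => \sum_(i <- r) f i u) w = \sum_(i <- r) lft p q (f i) w.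
Proof.
move=> q3 sf Uw; elim: r => [|i r IH].
  under [X in lft _ _ X _]eq_fun do rewrite big_nil.
  by rewrite big_nil lft_cst //; case: ifP.
rewrite big_cons -IH -lft_add //; last exact: smooth_sum.
by under [X in lft _ _ X _]eq_fun do rewrite big_cons.
Qed.

End ProlongationRules.

Arguments lft : simpl never.

(** * Jets of curves in coordinates *)

HB.lock Definition dt (R : realType) (f : R -> R) : R -> R := 'D_1 f.

(** The 2-jet at [0] of a curve in [R^n], in the coordinates of the bundle. *)
HB.lock Definition jet0 (R : realType) (n : nat) (f : R -> 'rV[R]_n) :
    'rV[R]_(n + n + n) :=
  row_mx (row_mx (f 0) (f^`()%classic 0)) (2^-1 *: f^`(2)%classic 0).

Section Jets.
Context {R : realType} {n : nat}.

Lemma dt_ext (A : set R) (f g : R -> R) t : open A -> (forall u, A u -> f u = g u) ->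
  A t -> dt f t = dt g t.
Proof.
by move=> oA fg At; rewrite dt.unlock; apply: near_eq_derive; exact: (open_near oA At).
Qed.

Lemma smooth_dt (A : set R) (f : R -> R) : smooth_on A f -> smooth_on A (dt f).
Proof. by rewrite dt.unlock; exact: smooth_derive. Qed.

Lemma dt_sum (I : Type) (r : seq I) (F : I -> R -> R) t :
  (forall i, differentiable (F i) t) ->
  dt (fun u => \sum_(i <- r) F i u) t = \sum_(i <- r) dt (F i) t.
Proof. by move=> dF; rewrite dt.unlock derive_sum_scalar. Qed.

Lemma dt_mul (f h : R -> R) t : differentiable f t -> differentiable h t ->
  dt (fun u => f u * h u) t = dt f t * h t + f t * dt h t.
Proof. by move=> df dh; rewrite dt.unlock derive_mul_scalar. Qed.

Lemma xpart_jet0 (f : R -> 'rV[R]_n) : xpart (jet0 f) = f 0.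
Proof. by rewrite /xpart jet0.unlock !row_mxKl. Qed.

Lemma jet0_slot (A : set R) (f : R -> 'rV[R]_n) s : open A -> A 0 -> smooth_on A f ->
  [/\ jet0 f 0 (slot 0 s) = f 0 0 s,
      jet0 f 0 (slot 1 s) = dt (fun t => f t 0 s) 0 &
      jet0 f 0 (slot 2 s) = 2^-1 * dt (dt (fun t => f t 0 s)) 0].
Proof.
move=> oA A0 sf.
have E1 t : A t -> 'D_1 f t 0 s = dt (fun t => f t 0 s) t.
  by move=> At; rewrite dt.unlock derive_mxE //; exact: smooth_diff sf At.
split.
- by rewrite jet0.unlock /slot !row_mxEl.
- by rewrite jet0.unlock /slot row_mxEl row_mxEr derive1E E1.
- rewrite jet0.unlock /slot row_mxEr mxE derive1nS derive1n1; congr (_ * _).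
  have -> : f^`()%classic = 'D_1 f by apply/funext => t; exact: derive1E.
  rewrite derive1E derive_mxE; last exact: smooth_diff (smooth_derive _ sf) A0.
  have -> : 'D_1 (fun t => 'D_1 f t 0 s) 0 = dt (fun t => 'D_1 f t 0 s) 0.
    by rewrite dt.unlock.
  exact: (dt_ext oA E1).
Qed.

Lemma dt_comp (f : R -> 'rV[R]_n) (h : 'rV[R]_n -> R) t :
  differentiable f t -> differentiable h (f t) ->
  dt (fun u => h (f u)) t = \sum_s dt (fun u => f u 0 s) t * pd s h (f t).
Proof.
move=> df dh; rewrite dt.unlock pd.unlock derive_comp_row //.
Qed.

Lemma jet0_ext (A : set R) (f g : R -> 'rV[R]_n) : open A -> A 0 ->
  (forall t, A t -> f t = g t) -> smooth_on A f -> jet0 f = jet0 g.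
Proof.
move=> oA A0 fg sf; have sg := smooth_ext oA fg sf.
apply/rowP; apply: slotP => k s k3.
have [f0 f1 f2] := jet0_slot s oA A0 sf; have [g0 g1 g2] := jet0_slot s oA A0 sg.
have fgs t : A t -> f t 0 s = g t 0 s by move=> At; rewrite fg.
have fg1 t : A t -> dt (fun t => f t 0 s) t = dt (fun t => g t 0 s) t.
  by move=> At; apply: (dt_ext oA).
case: k k3 => [|[|[|]]] // _; first by rewrite f0 g0 fgs.
  by rewrite f1 g1 fg1.
by rewrite f2 g2; congr (_ * _); apply: (dt_ext oA).
Qed.

(** The coordinates of a jet change by the prolongation of the change of
    coordinates of the base. *)
Lemma jet0_comp (A : set R) (U : set 'rV[R]_n) (f : R -> 'rV[R]_n)
    (F : 'rV[R]_n -> 'rV[R]_n) : open A -> A 0 -> open U ->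
  smooth_on A f -> smooth_on U F -> (forall t, A t -> U (f t)) ->
  jet0 (fun t => F (f t)) = tmap F (jet0 f).
Proof.
move=> oA A0 oU sf sF fU.
have sFf : smooth_on A (fun t => F (f t)) by exact: (smooth_comp_row oA oU fU sF sf).
have Uw : tube U (jet0 f) by rewrite /tube /= xpart_jet0; exact: fU.
apply/rowP; apply: slotP => k m k3; rewrite (tmap_slot oU sF) //.
have [c0 c1 c2] := jet0_slot m oA A0 sFf.
have j0 s : jet0 f 0 (slot 0 s) = f 0 0 s by have [] := jet0_slot s oA A0 sf.
have j1 s : jet0 f 0 (slot 1 s) = dt (fun t => f t 0 s) 0 by have [] := jet0_slot s oA A0 sf.
have j2 s : jet0 f 0 (slot 2 s) = 2^-1 * dt (dt (fun t => f t 0 s)) 0.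
  by have [] := jet0_slot s oA A0 sf.
have sFm : smooth_on U (fun x => F x 0 m) by have /smooth_mx := sF; apply.
have sfs s : smooth_on A (fun t => f t 0 s) by have /smooth_mx := sf; apply.
have sp s : smooth_on U (pd s (fun x => F x 0 m)) by exact: smooth_pd.
have spf s : smooth_on A (fun t => pd s (fun x => F x 0 m) (f t)).
  exact: (smooth_comp_row_scalar oA fU (sp s) sf).
have d1 t : A t -> dt (fun t => F (f t) 0 m) t =
    \sum_s dt (fun u => f u 0 s) t * pd s (fun x => F x 0 m) (f t).
  move=> At; apply: (dt_comp (h := fun x => F x 0 m)); first exact: smooth_diff sf At.
  exact: smooth_diff sFm (fU _ At).
case: k k3 => [|[|[|]]] // _.
- by rewrite c0 /prolong xpart_jet0.
- by rewrite c1 d1 // /prolong xpart_jet0; apply: eq_bigr => s _; rewrite j1.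
rewrite c2 (dt_ext oA d1 A0) dt_sum; last first.
  move=> s; apply: differentiableM; last exact: smooth_diff (spf s) A0.
  exact: smooth_diff (smooth_dt (sfs s)) A0.
rewrite /prolong xpart_jet0.
have E s : dt (fun u => dt (fun u0 => f u0 0 s) u * pd s (fun x => F x 0 m) (f u)) 0 =
    dt (dt (fun u => f u 0 s)) 0 * pd s (fun x => F x 0 m) (f 0) +
    dt (fun u => f u 0 s) 0 *
     (\sum_t dt (fun u => f u 0 t) 0 * pd t (pd s (fun x => F x 0 m)) (f 0)).
  rewrite dt_mul; last 2 first.
  - exact: smooth_diff (smooth_dt (sfs s)) A0.
  - exact: smooth_diff (spf s) A0.
  congr (_ + _ * _); apply: (dt_comp (h := pd s (fun x => F x 0 m))).
    exact: smooth_diff sf A0.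
  exact: smooth_diff (sp s) (fU _ A0).
under eq_bigr => s _ do rewrite E.
rewrite big_split /= mulrDr; congr (_ + _).
  by rewrite mulr_sumr; apply: eq_bigr => s _; rewrite j2 mulrA.
congr (_ * _); rewrite exchange_big /=; apply: eq_bigr => s _.
rewrite mulr_sumr; apply: eq_bigr => t _.
by rewrite !j1; ring.
Qed.

(** Cutting off a quadratic curve with a plateau function keeps it in a ball
    without changing it near [0]. *)
Lemma curve_of_jet (U : set 'rV[R]_n) (w : 'rV[R]_(n + n + n)) : open U -> tube U w ->
  exists f : R -> 'rV[R]_n,
    [/\ smooth_on setT f, (forall t, U (f t)) & jet0 f = w].
Proof.
move=> oU Uw; pose x := xpart w; pose y := ypart w; pose z := zpart w.
have [e /= e0 He] := (nbhs_ballP _ _).1 (open_nbhs_nbhs (conj oU Uw)).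
pose N := `|y| + `|z| + 1.
have N0 : 0 < N by rewrite ltr_wpDl // addr_ge0.
(* For |t| <= 2 d <= 2 the quadratic part has norm at most
   2 d |y| + 4 d |z| < 5 N d <= e. *)
pose d := Num.min 1 (e / (5 * N)).
have d0 : 0 < d by rewrite lt_min ltr01 divr_gt0 // mulr_gt0.
have d1 : d <= 1 by rewrite ge_min lexx.
have de : d * (5 * N) <= e.
  by rewrite -ler_pdivlMr ?mulr_gt0 // ge_min lexx orbT.
pose b t := plateau ((t / d) * (t / d)).
pose q t : 'rV[R]_n := t *: y + (t * t) *: z.
pose f t : 'rV[R]_n := x + b t *: q t.
have oT : open [set: R] by exact: openT.
have sid : smooth_on setT (fun t : R => t) by exact: id_smooth.
have sc (a : R) : smooth_on setT (fun _ : R => a) by exact: smooth_cst.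
have st : smooth_on setT (fun t : R => t / d) by exact: smooth_mul.
have sb : smooth_on setT b.
  apply: (smooth_comp_real (B := setT) (f := @plateau R)) => //.
    exact: smooth_plateau.
  exact: smooth_mul.
have sf : smooth_on setT f.
  apply/smooth_mx => // i s; rewrite ord1.
  apply: (smooth_ext oT (f := fun t => x 0 s + b t * (t * y 0 s + (t * t) * z 0 s))).
    by move=> t _; rewrite !mxE.
  apply: smooth_add => //; apply: smooth_mul => //.
  by apply: smooth_add => //; apply: smooth_mul => //; exact: smooth_mul.
exists f; split=> //.
- move=> t; apply: He; rewrite -ball_normE /= opprD addNKr normrN normrZ.
  have [r2|r2] := leP 2 (t / d * (t / d)).
    by rewrite /b plateau0 // normr0 mul0r.
  have td : `|t| <= 2 * d.
    rewrite -ler_pdivrMr // -[in X in _ / X](gtr0_norm d0) -normfV -normrM.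
    rewrite -[leRHS]ger0_norm // -ler_sqr ?nnegrE // !real_normK ?num_real //.
    by rewrite expr2 (le_trans (ltW r2)) // expr2; lra.
  have b1 : `|b t| <= 1 by rewrite ger0_norm ?plateau_ge0 ?plateau_le1.
  apply: (le_lt_trans (ler_piMl _ b1)) => //.
  apply: (le_lt_trans (ler_normD _ _)); rewrite !normrZ.
  have t2 : `|t| * `|t| <= 4 * d.
    apply: (@le_trans _ _ ((2 * d) * (2 * d))); first exact: ler_pM.
    rewrite (_ : 2 * d * (2 * d) = 4 * d * d); last by ring.
    by rewrite ler_piMr // mulr_ge0 // ltW.
  apply: (@le_lt_trans _ _ (2 * d * `|y| + 4 * d * `|z|)).
    by apply: lerD; apply: ler_wpM2r.
  apply: (lt_le_trans _ de); rewrite /N.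
  have [y0 z0] : 0 <= `|y| /\ 0 <= `|z| by [].
  move: y0 z0; move: (`|y|) (`|z|) => a c a0 c0.
  have da : 0 <= d * a by rewrite mulr_ge0 // ltW.
  have dc : 0 <= d * c by rewrite mulr_ge0 // ltW.
  by lra.
- have cb : \forall t \near (0 : R), `|t| < d.
    by apply/nbhs_normP; exists d => // t /=; rewrite sub0r normrN.
  have oA : open [set t : R | `|t| < d].
    have -> : [set t : R | `|t| < d] = ball (0 : R) d.
      by apply/seteqP; split=> t; rewrite -ball_normE /= sub0r normrN.
    exact: ball_open.
  set A := [set t : R | `|t| < d] in oA.
  have A0 : A 0 by rewrite /A /= normr0.
  have fA t : A t -> f t = x + q t.
    move=> At; rewrite /f /b plateau1 ?scale1r //.
    have td : `|t / d| <= 1 by rewrite normrM normfV (gtr0_norm d0) ler_pdivrMr // mul1r ltW.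
    rewrite -expr2 -(real_normK (num_real _)) expr2.
    by rewrite -[leRHS]mulr1 ler_pM.
  have sg : smooth_on A f by exact: smooth_onS sf.
  have fs t s : A t -> f t 0 s = x 0 s + (t * y 0 s + t * t * z 0 s).
    by move=> At; rewrite fA // !mxE.
  have D1 (a c r t : R) : dt (fun t => r + (t * a + t * t * c)) t = a + (t * c + t * c).
    rewrite dt.unlock.
    have H : is_derive t 1 (fun t => r + (t * a + t * t * c)) (a + (t * c + t * c)).
      apply: is_derive_eq; rewrite /GRing.scale /=; ring.
    by case: H.
  have D2 (a c t : R) : dt (fun t => a + (t * c + t * c)) t = 2 * c.
    rewrite dt.unlock.
    have H : is_derive t 1 (fun t => a + (t * c + t * c)) (2 * c).
      apply: is_derive_eq; rewrite /GRing.scale /=; ring.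
    by case: H.
  have E1 s t : A t -> dt (fun t => f t 0 s) t = y 0 s + (t * z 0 s + t * z 0 s).
    by move=> At; rewrite (dt_ext oA (fun t => fs t s) At) D1.
  apply/rowP; apply: slotP => k s k3; have [g0 g1 g2] := jet0_slot s oA A0 sg.
  case: k k3 => [|[|[|]]] // _.
  - by rewrite g0 fs // !mul0r !addr0 xpartE.
  - by rewrite g1 E1 // !mul0r !addr0 ypartE.
  - by rewrite g2 (dt_ext oA (E1 s) A0) D2 mulrA mulVf ?mul1r ?zpartE // pnatr_eq0.
Qed.

End Jets.

(** * The second-order tangent bundle is a manifold *)

Section JetBundle.
Context {R : realType} {n : nat} (M : charted R n).
Hypothesis mM : is_manifold M.

(** [jet_coord], with derivatives kept folded. *)
Definition jetc (i : idx M) (F : R -> M) := jet0 (fun t => chart_map i (F t)).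

Lemma jet_coordE : @jet_coord R n M = jetc.
Proof. by apply/funext => i; apply/funext => F; rewrite /jetc jet0.unlock. Qed.

Lemma xpart_jetc (i : idx M) (F : R -> M) : xpart (jetc i F) = chart_map i (F 0).
Proof. exact: xpart_jet0. Qed.

Lemma jetc_transition (i j : idx M) (F : R -> M) :
  smooth_curve F -> chart_dom i (F 0) -> chart_dom j (F 0) ->
  jetc j F = tmap (transition i j) (jetc i F).
Proof.
move=> sF Fi Fj; have [oi si] := sF i; have [oj sj] := sF j.
pose A := F @^-1` chart_dom i `&` F @^-1` chart_dom j.
have oA : open A by exact: openI.
have A0 : A 0 by [].
have si' : smooth_on A (fun t => chart_map i (F t)) by apply: smooth_onS si => t [].
have sj' : smooth_on A (fun t => chart_map j (F t)) by apply: smooth_onS sj => t [].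
rewrite /jetc -(jet0_comp oA A0 (open_overlap mM i j) si' (smooth_transition mM i j)).
  by apply: (jet0_ext oA A0 _ sj') => t [ti tj]; rewrite transitionE.
by move=> t [ti tj]; exact: overlap_in.
Qed.

(** Agreement of 2-jets in one chart implies agreement in all of them. *)
Lemma same_jet_chart (i : idx M) (F G : R -> M) :
  smooth_curve F -> smooth_curve G -> chart_dom i (F 0) -> F 0 = G 0 ->
  jetc i F = jetc i G -> same_jet F G.
Proof.
move=> sF sG Fi FG0 FG; rewrite /same_jet jet_coordE.
split; [exact: FG0|move=> j Fj].
have Gi : chart_dom i (G 0) by rewrite -FG0.
have Gj : chart_dom j (G 0) by rewrite -FG0.
by rewrite (jetc_transition sF Fi Fj) FG (jetc_transition sG Gi Gj).
Qed.

Lemma jet_classP (F G : R -> M) : smooth_curve G ->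
  jet_class F = jet_class G <-> same_jet F G.
Proof.
move=> sG; rewrite /jet_class /same_jet jet_coordE; split=> [FG|[FG0 FG]].
  have : [set H : R -> M | smooth_curve H /\
    G 0 = H 0 /\ (forall i, chart_dom i (G 0) -> jetc i G = jetc i H)] G by split.
  by rewrite -FG => -[].
apply/seteqP; split=> K /= [sK [FK0 FK]]; (split; [exact: sK|]); split.
- by rewrite -FG0.
- by move=> i Gi; rewrite -FG ?FK // FG0.
- by rewrite FG0.
- by move=> i Fi; rewrite FG // FK // -FG0.
Qed.

Lemma jet_reprP (P : jet2 M) :
  smooth_curve (jet_repr P) /\ sval P = jet_class (jet_repr P).
Proof. by rewrite /jet_repr; case: (cid (svalP P)). Qed.

Lemma jet_coord_inj (i : idx M) (P Q : jet2 M) :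
  chart_dom i (jet_repr P 0) -> chart_dom i (jet_repr Q 0) ->
  jetc i (jet_repr P) = jetc i (jet_repr Q) -> P = Q.
Proof.
move=> Pi Qi PQ; have [sP PE] := jet_reprP P; have [sQ QE] := jet_reprP Q.
have P0 : jet_repr P 0 = jet_repr Q 0.
  by apply: (chart_inj mM Pi Qi); rewrite -!xpart_jetc PQ.
have PQE : sval P = sval Q.
  by rewrite PE QE; apply/(jet_classP _ sQ); exact: (same_jet_chart sP sQ Pi P0 PQ).
by case: P Q PQE {PQ PE QE sP sQ Pi Qi P0} => [P HP] [Q HQ] /= PQ; exact: eq_exist.
Qed.

Lemma jet_of_curve (F : R -> M) : smooth_curve F -> exists P : jet2 M, same_jet F (jet_repr P).
Proof.
move=> sF; have HP : exists G, smooth_curve G /\ jet_class F = jet_class G by exists F.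
exists (exist _ (jet_class F) HP); set P := exist _ _ _.
by have [sP PE] := jet_reprP P; apply/(jet_classP _ sP); exact: PE.
Qed.

(** A jet is a class of curves defined on the whole line, so the curve that
    realizes [w] must not leave the chart. *)
Lemma jet_with_coord (i : idx M) (w : 'rV[R]_(n + n + n)) p :
  chart_dom i p -> chart_map i p = xpart w ->
  exists2 P : jet2 M, jet_repr P 0 = p & jetc i (jet_repr P) = w.
Proof.
move=> pi pw; have oi := open_chart_image mM i.
have Uw : tube (chart_image i) w by exists p.
have [f [sf fU fw]] := curve_of_jet oi Uw.
pose F t := sval (cid2 (fU t)).
have Fi t : chart_dom i (F t) by rewrite /F; case: cid2.
have Ff t : chart_map i (F t) = f t by rewrite /F; case: cid2.
have sF : smooth_curve F.
  move=> j; have -> : F @^-1` chart_dom j = f @^-1` overlap i j.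
    apply/seteqP; split=> t /=; rewrite -Ff; first by move=> tj; exact: overlap_in.
    by move=> /(overlapP mM (Fi t)).
  have oA : open (f @^-1` overlap i j).
    rewrite -[f @^-1` _]setTI; apply: open_preimage (open_overlap mM i j).
      exact: openT.
    by move=> t _; exact: smooth_diff sf _.
  split=> //; apply: (smooth_ext oA (f := fun t => transition i j (f t))).
    by move=> t; rewrite /= -Ff => /(overlapP mM (Fi t)) tj; rewrite transitionE.
  apply: (smooth_comp_row oA (open_overlap mM i j) _ (smooth_transition mM i j)) => //.
  exact: smooth_onS sf.
have jF : jetc i F = w by rewrite /jetc -fw; congr jet0; apply/funext.
have F0 : F 0 = p.
  by apply: (chart_inj mM (Fi 0) pi); rewrite pw -jF xpart_jetc.
have [P] := jet_of_curve sF; rewrite /same_jet jet_coordE => -[P0 PF].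
by exists P; rewrite -?P0 // -PF.
Qed.

Lemma T2_chart_mapE (i : idx M) (P : jet2 M) :
  @chart_map R _ (T2 M) i P = jetc i (jet_repr P).
Proof. by rewrite /chart_map /= jet_coordE. Qed.

(** Covers the chart images ([S] everything), the overlaps ([S] the domain of
    another chart) and the open sets pulled back from the base. *)
Lemma T2_image (i : idx M) (S : set M) :
  @chart_map R _ (T2 M) i @` ([set P | S (jet_repr P 0)] `&` @chart_dom R _ (T2 M) i) =
  tube (chart_map i @` (S `&` chart_dom i)).
Proof.
apply/seteqP; split=> w.
  move=> [P [SP Pi] <-]; rewrite T2_chart_mapE /tube /= xpart_jetc.
  by exists (jet_repr P 0).
move=> [p [Sp pi] pw]; have [P P0 Pw] := jet_with_coord pi pw.
by exists P; rewrite ?T2_chart_mapE //=; split; rewrite /= P0.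
Qed.

Lemma T2_overlap (i j : idx M) : @overlap R _ (T2 M) i j = tube (overlap i j).
Proof.
have := T2_image i (chart_dom j); rewrite setIC [chart_dom j `&` _]setIC; exact.
Qed.

Lemma T2_chart_image (i : idx M) : @chart_image R _ (T2 M) i = tube (chart_image i).
Proof. by have := T2_image i setT; rewrite !setTI. Qed.

Lemma T2_chart_transition (i j : idx M) (P : T2 M) :
  @chart_dom R _ (T2 M) i P -> @chart_dom R _ (T2 M) j P ->
  @chart_map R _ (T2 M) j P = tmap (transition i j) (@chart_map R _ (T2 M) i P).
Proof.
move=> Pi Pj; rewrite !T2_chart_mapE; apply: jetc_transition => //.
exact: (jet_reprP P).1.
Qed.

Lemma T2_transition (i j : idx M) w : tube (overlap i j) w ->
  @transition R _ (T2 M) i j w = tmap (transition i j) w.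
Proof.
rewrite -T2_overlap => -[P [Pi Pj] Pw].
rewrite /transition; case: xgetP => [w' _ [Q [Qi Qj Qw <-]]|].
  by rewrite (T2_chart_transition Qi Qj) Qw.
by move=> /(_ (@chart_map R _ (T2 M) j P)); case; exists P.
Qed.

Lemma smooth_tmap (U : set 'rV[R]_n) (F : 'rV[R]_n -> 'rV[R]_n) :
  open U -> smooth_on U F -> smooth_on (tube U) (tmap F).
Proof.
move=> oU sF; have oT := open_tube oU.
apply/smooth_mx => // i; rewrite ord1; apply: slotP => k m k3.
apply: (smooth_ext oT (f := prolong k (fun x => F x 0 m))).
  by move=> w Uw; rewrite (tmap_slot oU sF).
by apply: smooth_prolong => //; have /smooth_mx := sF; apply.
Qed.

(** Two jets over different points are separated in the base; over the same
    point they lie in one chart of the bundle and are separated there. *)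
Lemma T2_manifold : is_manifold (T2 M).
Proof.
have [_ _ _ [D cD HD] haus] := mM.
split.
- move=> i P Q Pi Qi; rewrite !T2_chart_mapE; exact: jet_coord_inj.
- by move=> i j; rewrite T2_overlap; apply: open_tube; exact: open_overlap.
- move=> i j; rewrite T2_overlap; have oO := open_overlap mM i j.
  have oT := open_tube oO.
  have sT := smooth_tmap oO (smooth_transition mM i j).
  apply: (smooth_ext oT _ sT) => w Uw; exact: esym (T2_transition Uw).
- by exists D => // P; have [i Di Pi] := HD (jet_repr P 0); exists i.
move=> P Q PQ; case: (pselect (jet_repr P 0 = jet_repr Q 0)) => [E|PQ0]; last first.
  have [A [B [oA oB AP BQ AB]]] := haus _ _ PQ0.
  exists [set K | A (jet_repr K 0)], [set K | B (jet_repr K 0)]; split=> //.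
  - by move=> i; rewrite T2_image; apply: open_tube; exact: oA.
  - by move=> i; rewrite T2_image; apply: open_tube; exact: oB.
  - by apply/seteqP; split=> // K [AK BK]; have : (A `&` B) (jet_repr K 0) by []; rewrite AB.
have [i _ Pi] := HD (jet_repr P 0); have Qi : chart_dom i (jet_repr Q 0) by rewrite -E.
pose cP := jetc i (jet_repr P); pose cQ := jetc i (jet_repr Q).
have cPQ : cP <> cQ by move=> H; apply: PQ; exact: (jet_coord_inj Pi Qi H).
have r0 : 0 < `|cP - cQ| / 2.
  by rewrite divr_gt0 // normr_gt0 subr_eq0; apply/eqP.
have opn (V : set 'rV[R]_(n + n + n)) : open V ->
    @mopen R _ (T2 M) [set K | chart_dom i (jet_repr K 0) /\ V (jetc i (jet_repr K))].
  move=> oV j.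
  have -> : @chart_map R _ (T2 M) j @`
      ([set K | chart_dom i (jet_repr K 0) /\ V (jetc i (jet_repr K))] `&`
       @chart_dom R _ (T2 M) j) =
      tube (@overlap R n M j i) `&` tmap (@transition R n M j i) @^-1` V.
    rewrite -T2_overlap; apply/seteqP; split=> w.
      move=> [K [[Ki VK] Kj] <-]; split; first by exists K.
      by rewrite /= -T2_chart_transition // T2_chart_mapE.
    move=> [[K [Kj Ki] <-]] /=; rewrite -T2_chart_transition // T2_chart_mapE => VK.
    by exists K.
  have oO := open_overlap mM j i.
  apply: open_preimage oV; first exact: open_tube.
  move=> w Uw; exact: smooth_diff (smooth_tmap oO (smooth_transition mM j i)) Uw.
exists [set K | chart_dom i (jet_repr K 0) /\
          ball cP (`|cP - cQ| / 2) (jetc i (jet_repr K))],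
       [set K | chart_dom i (jet_repr K 0) /\
          ball cQ (`|cP - cQ| / 2) (jetc i (jet_repr K))]; split.
- by apply: opn; exact: ball_open.
- by apply: opn; exact: ball_open.
- by split=> //; exact: ballxx.
- by split=> //; exact: ballxx.
apply/seteqP; split=> // K [[_ KP] [_ KQ]].
have : ball cP (`|cP - cQ| / 2 + `|cP - cQ| / 2) cQ.
  by apply: ball_triangle KP _; exact: ball_sym.
by rewrite -splitr -ball_normE /= ltxx.
Qed.

End JetBundle.

(** * Lifts of tensor fields as matrices of prolongations *)

Section LiftedMatrices.
Context {R : realType} {n : nat}.
Implicit Types (A B h J : 'rV[R]_n -> 'M[R]_n) (w : 'rV[R]_(n + n + n)).

Definition slot_inv (j : 'I_(n + n + n)) : nat * 'I_n :=
  match fintype.split j with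
  | inl j' => match fintype.split j' with inl s => (0%N, s) | inr s => (1%N, s) end
  | inr s => (2%N, s)
  end.

Definition wt j : nat := (slot_inv j).1.
Definition bs j : 'I_n := (slot_inv j).2.

Lemma slot_invK k s : (k < 3)%N -> slot_inv (slot k s) = (k, s).
Proof.
have Kl m p (t : 'I_m) : fintype.split (lshift p t) = inl t by exact: (unsplitK (inl t)).
have Kr m p (t : 'I_p) : fintype.split (rshift m t) = inr t by exact: (unsplitK (inr t)).
by case: k => [|[|[|]]] // _; rewrite /slot_inv /slot ?Kl ?Kr ?Kl.
Qed.

Lemma wt_slot k s : (k < 3)%N -> wt (slot k s) = k.
Proof. by move=> k3; rewrite /wt slot_invK. Qed.

Lemma bs_slot k s : (k < 3)%N -> bs (slot k s) = s.
Proof. by move=> k3; rewrite /bs slot_invK. Qed.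

Lemma wt_lt3 j : (wt j < 3)%N.
Proof. by move: j; apply: slotP => k s k3; rewrite wt_slot. Qed.

Lemma slot_wt_bs j : slot (wt j) (bs j) = j.
Proof. by move: j; apply: slotP => k s k3; rewrite wt_slot // bs_slot. Qed.

Lemma sum_wt_bs (F : nat -> 'I_n -> R) :
  \sum_j F (wt j) (bs j) = \sum_(k < 3) \sum_s F k s.
Proof.
rewrite sum_slot; apply: eq_bigr => k _; apply: eq_bigr => s _.
by rewrite wt_slot // bs_slot.
Qed.

(** The lift of an endomorphism field, and of the differential of a map. *)
Definition jlift J w : 'M[R]_(n + n + n) :=
  \matrix_(i, j) lft (wt i) (wt j) (fun u => J u (bs i) (bs j)) w.

(** The second lift ([q = 2]) and the vertical lift ([q = 0]) of a bilinear
    form: both are instances of one formula. *)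
Definition mlift (q : nat) h w : 'M[R]_(n + n + n) :=
  \matrix_(i, j) lft (wt i + wt j) q (fun u => h u (bs i) (bs j)) w.

Lemma jlift_slot J k a l b w : (k < 3)%N -> (l < 3)%N ->
  jlift J w (slot k a) (slot l b) = lft k l (fun u => J u a b) w.
Proof. by move=> k3 l3; rewrite mxE !wt_slot // !bs_slot. Qed.

Lemma mlift_slot q h k a l b w : (k < 3)%N -> (l < 3)%N ->
  mlift q h w (slot k a) (slot l b) = lft (k + l) q (fun u => h u a b) w.
Proof. by move=> k3 l3; rewrite mxE !wt_slot // !bs_slot. Qed.

Lemma mlift_tr q h w : (mlift q h w)^T = mlift q (fun u => (h u)^T) w.
Proof.
by apply/matrixP => i j; rewrite !mxE addnC; under [in RHS]eq_fun do rewrite mxE.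
Qed.

Section OnOpen.
Variable U : set 'rV[R]_n.
Hypothesis oU : open U.

Lemma mlift_ext q h h' w : (forall x, U x -> h x = h' x) -> tube U w ->
  mlift q h w = mlift q h' w.
Proof.
move=> hh Uw; apply/matrixP => i j; rewrite !mxE.
by apply: (lft_ext oU) Uw => x Ux; rewrite hh.
Qed.

Lemma jlift_ext J J' w : (forall x, U x -> J x = J' x) -> tube U w ->
  jlift J w = jlift J' w.
Proof.
move=> JJ Uw; apply/matrixP => i j; rewrite !mxE.
by apply: (lft_ext oU) Uw => x Ux; rewrite JJ.
Qed.

Lemma smooth_mlift q h : smooth_on U h -> smooth_on (tube U) (mlift q h).
Proof.
move=> sh; apply/smooth_mx; first exact: open_tube.
move=> i j; under eq_fun do rewrite mxE.
by apply: smooth_lft => //; have /smooth_mx := sh; apply.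
Qed.

Lemma smooth_jlift J : smooth_on U J -> smooth_on (tube U) (jlift J).
Proof.
move=> sJ; apply/smooth_mx; first exact: open_tube.
move=> i j; under eq_fun do rewrite mxE.
by apply: smooth_lft => //; have /smooth_mx := sJ; apply.
Qed.

Lemma entry_smooth m p (h : 'rV[R]_n -> 'M[R]_(m, p)) a b :
  smooth_on U h -> smooth_on U (fun u => h u a b).
Proof. by move/smooth_mx; apply. Qed.

Lemma lft_mulmx k a q J h i j w : (q < 3)%N -> smooth_on U J -> smooth_on U h ->
  tube U w ->
  \sum_(m < 3) \sum_s lft k m (fun u => J u i s) w * lft (m + a) q (fun u => h u s j) w =
  lft (k + a) q (fun u => (J u *m h u) i j) w.
Proof.
move=> q3 sJ sh Uw.
have sJE s := entry_smooth i s sJ; have shE s := entry_smooth s j sh.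
under [X in lft _ _ X]eq_fun do rewrite mxE.
rewrite (lft_sum oU) //; last by move=> s; exact: smooth_mul.
rewrite exchange_big /=; apply: eq_bigr => s _.
by rewrite (lft_mul oU).
Qed.

Lemma jlift_mulmx J A w : smooth_on U J -> smooth_on U A -> tube U w ->
  jlift J w *m jlift A w = jlift (fun u => J u *m A u) w.
Proof.
move=> sJ sA Uw; apply/matrixP => i j; rewrite !mxE.
under eq_bigr do rewrite !mxE.
rewrite (sum_wt_bs (fun m s => lft (wt i) m (fun u => J u (bs i) s) w *
   lft m (wt j) (fun u => A u s (bs j)) w)).
have := @lft_mulmx (wt i) 0 (wt j) J A (bs i) (bs j) w (wt_lt3 j) sJ sA Uw.
rewrite addn0 => <-.
by apply: eq_bigr => m _; apply: eq_bigr => s _; rewrite addn0.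
Qed.

Lemma jlift_mlift q J h w : (q < 3)%N -> smooth_on U J -> smooth_on U h -> tube U w ->
  jlift J w *m mlift q h w = mlift q (fun u => J u *m h u) w.
Proof.
move=> q3 sJ sh Uw; apply/matrixP => i j; rewrite !mxE.
under eq_bigr do rewrite !mxE.
rewrite (sum_wt_bs (fun m s => lft (wt i) m (fun u => J u (bs i) s) w *
   lft (m + wt j) q (fun u => h u s (bs j)) w)).
exact: lft_mulmx.
Qed.

Lemma smooth_tr m p (h : 'rV[R]_n -> 'M[R]_(m, p)) :
  smooth_on U h -> smooth_on U (fun u => (h u)^T).
Proof.
move=> sh; apply/smooth_mx => // i j; under eq_fun do rewrite mxE.
exact: entry_smooth.
Qed.

Lemma smooth_mulmx m p r (h : 'rV[R]_n -> 'M[R]_(m, p)) (k : 'rV[R]_n -> 'M[R]_(p, r)) :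
  smooth_on U h -> smooth_on U k -> smooth_on U (fun u => h u *m k u).
Proof.
move=> sh sk; apply/smooth_mx => // i j; under eq_fun do rewrite mxE.
by apply: smooth_sum => // s; apply: smooth_mul => //; exact: entry_smooth.
Qed.

Lemma mlift_jlift_tr q J h w : (q < 3)%N -> smooth_on U J -> smooth_on U h -> tube U w ->
  mlift q h w *m (jlift J w)^T = mlift q (fun u => h u *m (J u)^T) w.
Proof.
move=> q3 sJ sh Uw; apply: trmx_inj; rewrite trmx_mul trmxK !mlift_tr jlift_mlift //.
  by apply: mlift_ext Uw => x _; rewrite trmx_mul trmxK.
exact: smooth_tr.
Qed.

Lemma jlift_cst a w : jlift (fun=> a%:M) w = a%:M.
Proof.
apply/matrixP => i j; rewrite !mxE lft_cst ?wt_lt3 //.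
rewrite -{3}(slot_wt_bs i) -{3}(slot_wt_bs j) slot_eq ?wt_lt3 //.
by case: eqP => //= _; rewrite mulr0n.
Qed.

Section Map.
Variables (V : set 'rV[R]_n) (F : 'rV[R]_n -> 'rV[R]_n).
Hypotheses (oV : open V) (sF : smooth_on U F) (FV : forall x, U x -> V (F x)).

Lemma mlift_comp q h w : (q < 3)%N -> smooth_on V h -> tube U w ->
  mlift q h (tmap F w) = mlift q (fun u => h (F u)) w.
Proof.
move=> q3 sh Uw; apply/matrixP => i j; rewrite !mxE /lft; case: ifP => // _.
apply/esym/(prolong_comp oU sF FV (f := fun x => h x (bs i) (bs j))) => //.
  exact: leq_ltn_trans (leq_subr _ _) q3.
by have /smooth_mx := sh; apply.
Qed.

(** The differential of a prolongation is the lift of the differential, which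
    is why lifts of tensors transform as tensors. *)
Lemma jacobian_tmap w : tube U w -> 'J (tmap F) w = jlift (fun u => 'J F u) w.
Proof.
move=> Uw; have oT := open_tube oU.
have dT : differentiable (tmap F) w by exact: smooth_diff (smooth_tmap oU sF) Uw.
have sFm m : smooth_on U (fun u => F u 0 m) by exact: entry_smooth.
apply/matrixP => i j; rewrite jacobianE // mxE -[j]slot_wt_bs -[i]slot_wt_bs.
move: (wt_lt3 i) (wt_lt3 j) => k3 l3; rewrite !wt_slot // !bs_slot //.
set k := wt i in k3 *; set l := wt j in l3 *; set a := bs i; set b := bs j.
have -> : partial (slot k a) (fun u => tmap F u 0 (slot l b)) w =
          pd (slot k a) (lft 0 l (fun u => F u 0 b)) w.
  rewrite pd.unlock; apply: near_eq_derive; apply: (open_near oT Uw) => v Uv.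
  by rewrite (tmap_slot oU sF) // /lft subn0.
rewrite (pd_lft oU) // add0n; apply: (lft_ext oU) Uw => x Ux.
rewrite jacobianE ?pd.unlock //; exact: smooth_diff sF Ux.
Qed.

End Map.

Lemma phi_pd J c k a b x : phi J c k a b x =
  \sum_m J x k m * pd m (fun u => c u a b) x
  - pd k (fun u => (J u *m c u) a b) x
  + \sum_m pd a (fun u => J u k m) x * c x m b
  + \sum_m pd b (fun u => J u k m) x * c x a m.
Proof. by rewrite /phi pd.unlock. Qed.

End OnOpen.
End LiftedMatrices.

Section PhiLift.
Context {R : realType} {n : nat}.
Variable U : set 'rV[R]_n.
Hypothesis oU : open U.
Implicit Types (h J : 'rV[R]_n -> 'M[R]_n) (w : 'rV[R]_(n + n + n)).

(** The lifts commute with products and with partial derivatives, hence with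
    the Tachibana operator. *)
Lemma phi_lift q J h i j l w : (q < 3)%N -> smooth_on U J -> smooth_on U h -> tube U w ->
  phi (jlift J) (mlift q h) i j l w =
  lft (wt i + wt j + wt l) q (phi J h (bs i) (bs j) (bs l)) w.
Proof.
move=> q3 sJ sh Uw; have oT := open_tube oU.
have sJE a b := entry_smooth oU a b sJ; have shE a b := entry_smooth oU a b sh.
have sJh := smooth_mulmx oU sJ sh.
have sJhE a b := entry_smooth oU a b sJh.
rewrite phi_pd; set k := bs i; set a := bs j; set b := bs l.
set ki := wt i; set kj := wt j; set kl := wt l.
have [i3 j3 l3] : [/\ (ki < 3)%N, (kj < 3)%N & (kl < 3)%N] by split; exact: wt_lt3.
have pdw (m : 'I_(n + n + n)) p r (f : 'rV[R]_n -> R) : (r < 3)%N -> smooth_on U f ->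
    pd m (lft p r f) w = lft (p + wt m) r (pd (bs m) f) w.
  by move=> r3 sf; rewrite -{1}(slot_wt_bs m) (pd_lft oU) // wt_lt3.
have T1 : \sum_m jlift J w i m * pd m (fun u => mlift q h u j l) w =
    lft (ki + kj + kl) q (fun x => \sum_s J x k s * pd s (fun u => h u a b) x) w.
  rewrite (lft_sum oU) //; last by move=> s; apply: smooth_mul => //; exact: smooth_pd.
  have -> : (fun u => mlift q h u j l) = lft (kj + kl) q (fun u => h u a b).
    by apply/funext => u; rewrite mxE.
  under eq_bigr => m _ do rewrite mxE (pdw m) // addnC.
  rewrite (sum_wt_bs (fun m s => lft ki m (fun u => J u k s) w *
    lft (m + (kj + kl)) q (pd s (fun u => h u a b)) w)).
  rewrite exchange_big /=; apply: eq_bigr => s _.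
  by rewrite (lft_mul oU) ?addnA //; exact: smooth_pd.
have T2 : pd i (fun u => (jlift J u *m mlift q h u) j l) w =
    lft (ki + kj + kl) q (pd k (fun u => (J u *m h u) a b)) w.
  have E u : tube U u ->
      (jlift J u *m mlift q h u) j l = lft (kj + kl) q (fun u => (J u *m h u) a b) u.
    by move=> Uu; rewrite (jlift_mlift oU) // mxE.
  by rewrite (pd_ext i oT E Uw) pdw // addnC addnA.
have TJ m v : pd v (fun u => jlift J u i m) w =
    lft (ki + wt v) (wt m) (pd (bs v) (fun u => J u k (bs m))) w.
  have -> : (fun u => jlift J u i m) = lft ki (wt m) (fun u => J u k (bs m)).
    by apply/funext => u; rewrite mxE.
  by rewrite pdw // wt_lt3.
have T3 : \sum_m pd j (fun u => jlift J u i m) w * mlift q h w m l =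
    lft (ki + kj + kl) q (fun x => \sum_s pd a (fun u => J u k s) x * h x s b) w.
  rewrite (lft_sum oU) //; last by move=> s; apply: smooth_mul => //; exact: smooth_pd.
  under eq_bigr => m _ do rewrite (TJ m j) mxE.
  rewrite (sum_wt_bs (fun m s => lft (ki + kj) m (pd a (fun u => J u k s)) w *
    lft (m + kl) q (fun u => h u s b) w)).
  rewrite exchange_big /=; apply: eq_bigr => s _.
  by rewrite (lft_mul oU) //; exact: smooth_pd.
have T4 : \sum_m pd l (fun u => jlift J u i m) w * mlift q h w j m =
    lft (ki + kj + kl) q (fun x => \sum_s pd b (fun u => J u k s) x * h x a s) w.
  rewrite (lft_sum oU) //; last by move=> s; apply: smooth_mul => //; exact: smooth_pd.
  under eq_bigr => m _ do rewrite (TJ m l) mxE [(wt j + _)%N]addnC.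
  rewrite (sum_wt_bs (fun m s => lft (ki + kl) m (pd b (fun u => J u k s)) w *
    lft (m + kj) q (fun u => h u a s) w)).
  rewrite exchange_big /=; apply: eq_bigr => s _.
  by rewrite (lft_mul oU) // ?[(ki + kl + kj)%N]addnAC //; exact: smooth_pd.
rewrite T1 T2 T3 T4.
have s1 : smooth_on U (fun x => \sum_s J x k s * pd s (fun u => h u a b) x).
  by apply: smooth_sum => // s; apply: smooth_mul => //; exact: smooth_pd.
have s2 : smooth_on U (pd k (fun u => (J u *m h u) a b)) by exact: smooth_pd.
have s3 : smooth_on U (fun x => \sum_s pd a (fun u => J u k s) x * h x s b).
  by apply: smooth_sum => // s; apply: smooth_mul => //; exact: smooth_pd.
have s4 : smooth_on U (fun x => \sum_s pd b (fun u => J u k s) x * h x a s).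
  by apply: smooth_sum => // s; apply: smooth_mul => //; exact: smooth_pd.
have s2' : smooth_on U (fun x => - pd k (fun u => (J u *m h u) a b) x) by exact: smooth_opp.
rewrite -(lft_opp oU) // -!(lft_add oU) //.
- by apply: (lft_ext oU) Uw => x _; rewrite phi_pd.
- by apply: smooth_add => //; exact: smooth_add.
- exact: smooth_add.
Qed.

Lemma phi_add J h h' k a b x :
  differentiable J x -> differentiable h x -> differentiable h' x ->
  phi J (fun u => h u + h' u) k a b x = phi J h k a b x + phi J h' k a b x.
Proof.
move=> dJ dh dh'.
have /differentiable_mx dhE := dh; have /differentiable_mx dhE' := dh'.
have /differentiable_mx d1 := differentiable_mulmx dJ dh.
have /differentiable_mx d2 := differentiable_mulmx dJ dh'.
have p1 m c d : pd m (fun u => (h u + h' u) c d) x =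
    pd m (fun u => h u c d) x + pd m (fun u => h' u c d) x.
  by under eq_fun do rewrite mxE; rewrite pd_add.
have p2 m c d : pd m (fun u => (J u *m (h u + h' u)) c d) x =
    pd m (fun u => (J u *m h u) c d) x + pd m (fun u => (J u *m h' u) c d) x.
  by under eq_fun do rewrite mulmxDr mxE; rewrite pd_add.
rewrite !phi_pd p2.
under eq_bigr do rewrite p1 mulrDr.
under [X in _ - _ + X + _]eq_bigr do rewrite mxE mulrDr.
under [X in _ - _ + _ + X]eq_bigr do rewrite mxE mulrDr.
rewrite !big_split /=.
have regroup (a1 a2 b1 b2 c1 c2 d1' d2' : R) :
  a1 + a2 - (b1 + b2) + (c1 + c2) + (d1' + d2') =
  a1 - b1 + c1 + d1' + (a2 - b2 + c2 + d2') by ring.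
exact: regroup.
Qed.

Lemma phi_ext m (V : set 'rV[R]_m) (J J' h h' : 'rV[R]_m -> 'M[R]_m) k a b x :
  open V -> (forall u, V u -> J u = J' u) -> (forall u, V u -> h u = h' u) -> V x ->
  phi J h k a b x = phi J' h' k a b x.
Proof.
move=> oV JJ hh Vx; rewrite !phi_pd JJ // hh //.
have pJ t c d : pd t (fun u => J u c d) x = pd t (fun u => J' u c d) x.
  by apply: (pd_ext t oV _ Vx) => u Vu; rewrite JJ.
have ph t c d : pd t (fun u => h u c d) x = pd t (fun u => h' u c d) x.
  by apply: (pd_ext t oV _ Vx) => u Vu; rewrite hh.
have -> : pd k (fun u => (J u *m h u) a b) x = pd k (fun u => (J' u *m h' u) a b) x.
  by apply: (pd_ext k oV _ Vx) => u Vu; rewrite JJ // hh.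
under eq_bigr do rewrite ph.
under [X in _ - _ + X + _]eq_bigr do rewrite pJ.
by under [X in _ - _ + _ + X]eq_bigr do rewrite pJ.
Qed.

End PhiLift.

Section ConcreteLifts.
Context {R : realType} {n : nat} (M : charted R n).
Hypothesis mM : is_manifold M.

Lemma lift1_mxE m p (f : 'rV[R]_n -> 'M[R]_(m, p)) x y a b : differentiable f x ->
  lift1 f x y a b = lift1 (fun u => f u a b) x y.
Proof.
move=> df; rewrite /lift1 summxE; apply: eq_bigr => s _.
by rewrite mxE /partial derive_mxE.
Qed.

Lemma lift2_mxE m p (U : set 'rV[R]_n) (f : 'rV[R]_n -> 'M[R]_(m, p)) x y z a b :
  open U -> smooth_on U f -> U x ->
  lift2 f x y z a b = lift2 (fun u => f u a b) x y z.
Proof.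
move=> oU sf Ux; rewrite /lift2 mxE summxE mxE summxE.
have E1 : \sum_s (z 0 s *: partial s f x) a b =
          \sum_s z 0 s *: partial s (fun u => f u a b) x.
  apply: eq_bigr => s _; rewrite mxE /partial derive_mxE //.
  exact: smooth_diff sf Ux.
rewrite E1; congr (_ + _ * _); apply: eq_bigr => t _.
rewrite summxE; apply: eq_bigr => s _; rewrite mxE; congr (_ * _).
rewrite /partial derive_mxE; last exact: smooth_diff (smooth_derive _ sf) Ux.
apply: near_eq_derive; apply: (open_near oU Ux) => u Uu.
by rewrite derive_mxE //; exact: smooth_diff sf Uu.
Qed.

Lemma deformed_lift2E (g c : mcomp M) i w : smooth_on (chart_image i) (g i) ->
  tube (chart_image i) w ->
  deformed_lift2 g c i w = mlift 2 (g i) w + mlift 0 (c i) w.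
Proof.
move=> sg Uw; have oU := open_chart_image mM i.
have dg : differentiable (g i) (xpart w) by exact: smooth_diff sg Uw.
have L1 a b : lift1 (g i) (xpart w) (ypart w) a b = lft 1 2 (fun u => g i u a b) w.
  by rewrite lift1_mxE // prolong_lift1.
have L2 a b : lift2 (g i) (xpart w) (ypart w) (zpart w) a b = lft 0 2 (fun u => g i u a b) w.
  by rewrite (lift2_mxE _ _ _ _ oU sg Uw) prolong_lift2.
apply/matrixP; apply: slotP => k a k3; apply: slotP => l b l3.
rewrite [RHS]mxE !mlift_slot //.
case: k k3 => [|[|[|]]] // _; case: l l3 => [|[|[|]]] // _; rewrite /deformed_lift2 /slot.
- by rewrite !block_mxEul mxE L2.
- by rewrite block_mxEul block_mxEur L1 [lft _ 0 _ _]/lft addr0.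
- by rewrite block_mxEur col_mxEu [lft _ 0 _ _]/lft addr0.
- by rewrite block_mxEul block_mxEdl L1 [lft _ 0 _ _]/lft addr0.
- by rewrite block_mxEul block_mxEdr [lft _ 0 _ _]/lft addr0.
- by rewrite block_mxEur col_mxEd mxE /lft addr0.
- by rewrite block_mxEdl row_mxEl [lft _ 0 _ _]/lft addr0.
- by rewrite block_mxEdl row_mxEr mxE /lft addr0.
- by rewrite block_mxEdr mxE /lft addr0.
Qed.

End ConcreteLifts.

Section LiftOfJ.
Context {R : realType} {n : nat} (M : charted R n).
Hypothesis mM : is_manifold M.

Definition lift_vf (k : nat) (X : vcomp M) : vcomp (T2 M) :=
  match k with 0 => lift2_vf X | 1 => lift1_vf X | _ => lift0_vf X end.

Lemma lift_vf_slot k (X : vcomp M) i (U : set 'rV[R]_n) l b w :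
  (k < 3)%N -> (l < 3)%N -> open U -> smooth_on U (X i) -> tube U w ->
  lift_vf k X i w 0 (slot l b) = lft k l (fun u => X i u 0 b) w.
Proof.
move=> k3 l3 oU sX Uw.
have H m : (m < 3)%N -> tmap (X i) w 0 (slot m b) = prolong m (fun u => X i u 0 b) w.
  by move=> m3; exact: (tmap_slot oU sX).
case: k k3 => [|[|[|]]] // _; rewrite /lift_vf.
- by rewrite /lft subn0 -H.
- have := H 0%N isT; have := H 1%N isT.
  rewrite /tmap {1 3}/slot row_mxEl row_mxEr !row_mxEl => H1 H0.
  case: l l3 => [|[|[|]]] // _; rewrite /lift1_vf /slot.
  + by rewrite !row_mxEl mxE.
  + by rewrite row_mxEl row_mxEr H0.
  + by rewrite row_mxEr H1.
- have := H 0%N isT; rewrite /tmap {1}/slot !row_mxEl => H0.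
  case: l l3 => [|[|[|]]] // _; rewrite /lift0_vf /slot.
  + by rewrite !row_mxEl mxE.
  + by rewrite row_mxEl row_mxEr mxE.
  + by rewrite row_mxEr H0.
Qed.

(** The lifts of fields that are constant near a point are the coordinate
    fields of the bundle over that point, so they determine the lift of [J]. *)
Lemma is_lift2_11E (J : mcomp M) (JJ : mcomp (T2 M)) (i : idx M) w :
  (forall i, smooth_on (chart_image i) (J i)) -> is_lift2_11 J JJ ->
  tube (chart_image i) w -> JJ i w = jlift (J i) w.
Proof.
move=> sJ [_ HJ] Uw; have oU := open_chart_image mM i.
apply/matrixP; apply: slotP => k a k3; apply: slotP => l b l3.
rewrite jlift_slot //.
have [X vX nX] := local_constant_field mM (delta_mx 0 a) Uw.
have [V [oV Vx] XV] : exists2 V : set 'rV[R]_n, open V /\ V (xpart w) &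
    forall u, V u -> chart_image i u /\ X i u = delta_mx 0 a.
  exists (interior [set u | X i u = delta_mx 0 a] `&` chart_image i).
    split; last by split.
    by apply: openI oU; exact: open_interior.
  by move=> u [/interior_subset Xu cu].
have cw : @chart_image R _ (T2 M) i w by rewrite T2_chart_image.
have [H2 H1 H0] := HJ X vX i w cw.
have H m : (m < 3)%N -> lift_vf m X i w *m JJ i w = lift_vf m (app J X) i w.
  by case: m => [|[|[|]]].
have sX : smooth_on V (X i) by case: vX => sX _; apply: smooth_onS (@sX i) => u /XV[].
have sJV : smooth_on V (J i) by apply: smooth_onS (@sJ i) => u /XV[].
have sJX : smooth_on V (app J X i) by exact: smooth_mulmx.
have rowX : lift_vf k X i w = delta_mx 0 (slot k a).
  apply/rowP; apply: slotP => m c m3.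
  rewrite (lift_vf_slot c k3 m3 oV sX Vx).
  rewrite (lft_ext oV k m (h := fun=> (c == a)%:R) _ Vx); last first.
    by move=> u /XV[_ ->]; rewrite mxE eqxx.
  rewrite lft_cst // mxE eqxx slot_eq // [m == k]eq_sym.
  by case: (k == m).
have /rowP/(_ (slot l b)) := H k k3; rewrite rowX -rowE mxE => ->.
rewrite (lift_vf_slot b k3 l3 oV sJX Vx).
by apply: (lft_ext oV _ _ _ Vx) => u /XV[_ Xu]; rewrite /app Xu -rowE mxE.
Qed.

End LiftOfJ.

(** * The deformed lift is a pseudo-Riemannian metric *)

Section LiftedMetric.
Context {R : realType} {n : nat} (M : charted R n).
Hypothesis mM : is_manifold M.
Variables g c : mcomp M.
Hypotheses (sg : symmetric_tensor02 g) (sc : symmetric_tensor02 c).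
Hypothesis gu : forall i x, chart_image i x -> g i x \in unitmx.

Let smg i : smooth_on (chart_image i) (g i).
Proof. by case: sg => -[]. Qed.

Let smc i : smooth_on (chart_image i) (c i).
Proof. by case: sc => -[]. Qed.

(** The matrix is block antitriangular with blocks [g] on the antidiagonal. *)
Lemma deformed_lift2_unit (i : idx M) w : tube (chart_image i) w ->
  deformed_lift2 g c i w \in unitmx.
Proof.
move=> Uw; rewrite (deformed_lift2E mM) //.
rewrite -row_free_unit -kermx_eq0; apply/rowV0P => v /sub_kermxP vG.
have gx := gu Uw.
pose vk k := \row_a v 0 (slot k a).
have E l b : (l < 3)%N -> \sum_(k < 3) \sum_a v 0 (slot k a) *
    (lft (k + l) 2 (fun u => g i u a b) w + lft (k + l) 0 (fun u => c i u a b) w) = 0.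
  move=> l3; have /rowP/(_ (slot l b)) := vG.
  rewrite mxE sum_slot [RHS]mxE => vGlb; rewrite -[RHS]vGlb.
  apply: eq_bigr => k _; apply: eq_bigr => a _.
  by rewrite [in RHS]mxE !mlift_slot.
have K (k : nat) : (forall b, \sum_a v 0 (slot k a) * g i (xpart w) a b = 0) ->
    forall a, v 0 (slot k a) = 0.
  move=> Hk a; have : vk k *m g i (xpart w) = 0.
    by apply/rowP => b; rewrite !mxE -[RHS](Hk b); apply: eq_bigr => s _; rewrite mxE.
  move=> /(congr1 (mulmx^~ (invmx (g i (xpart w))))); rewrite mulmxK // mul0mx.
  by move/rowP/(_ a); rewrite !mxE.
(* Ascending weights: in the column block of weight 2 - m, the row blocks of
   weight above m vanish, and that of weight m is g. *)
have z m (m3 : (m < 3)%N) : (forall k, (k < m)%N -> forall a, v 0 (slot k a) = 0) ->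
    forall a, v 0 (slot m a) = 0.
  move=> IH; apply: K => b.
  have m2 : (m <= 2)%N by [].
  have l3 : (2 - m < 3)%N by rewrite ltnS leq_subr.
  have := E (2 - m)%N b l3; rewrite (bigD1 (Ordinal m3)) //= [X in _ + X]big1 ?addr0.
    move=> sum0; rewrite -[RHS]sum0; apply: eq_bigr => a _; congr (_ * _).
    by rewrite subnKC // /lft /= addr0.
  move=> k; rewrite -val_eqE /= neq_ltn => /orP[km|mk]; apply: big1 => a _.
    by rewrite IH // mul0r.
  have k2 : (2 < k + (2 - m))%N by lia.
  by rewrite /lft leqNgt k2 /= leqn0 gtn_eqF ?addr0 ?mulr0 //; lia.
apply/rowP; apply: slotP => k a k3; rewrite mxE; move: a.
elim/ltn_ind: k k3 => k IH k3; apply: z => // l lk; apply: IH => //.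
exact: ltn_trans lk k3.
Qed.

Lemma deformed_lift2_transition (i j : idx M) w : tube (overlap i j) w ->
  deformed_lift2 g c i w =
  'J (@transition R _ (T2 M) i j) w *m
    deformed_lift2 g c j (@transition R _ (T2 M) i j w) *m
    ('J (@transition R _ (T2 M) i j) w)^T.
Proof.
move=> ow.
have oO := open_overlap mM i j; have st := smooth_transition mM i j.
have sJ := @smooth_jacobian _ _ _ mM i j.
have oj := open_chart_image mM j; have oi := open_chart_image mM i.
have inj x : overlap i j x -> chart_image j (transition i j x).
  by move=> ox; apply: overlap_chart_image; exact: (transition_overlap mM ox).
have ini x : overlap i j x -> chart_image i x by exact: overlap_chart_image.
rewrite (deformed_lift2E mM) //; last exact: ini.
rewrite T2_transition // (deformed_lift2E mM) //; last first.
  by rewrite /tube /= xpart_tmap; exact: inj.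
have -> : 'J (@transition R _ (T2 M) i j) w = jlift (jacobian (@transition R n M i j)) w.
  rewrite -(jacobian_tmap oO st ow); apply/esym/near_eq_jacobian.
    apply: (open_near (open_tube oO) ow) => v ov; exact/esym/(T2_transition mM ov).
  exact: smooth_diff (smooth_tmap oO st) ow.
have tensor q (h : mcomp M) : (q < 3)%N -> tensor02 h -> mlift q (h i) w =
    jlift (jacobian (@transition R n M i j)) w *m mlift q (h j) (tmap (transition i j) w)
    *m (jlift (jacobian (@transition R n M i j)) w)^T.
  move=> q3 [sh th]; rewrite (mlift_comp oO oj st inj q3 (@sh j) ow).
  have shj : smooth_on (overlap i j) (fun u => h j (transition i j u)).
    exact: smooth_comp_row oO oj inj (@sh j) st.
  rewrite (jlift_mlift oO q3 sJ shj ow) (mlift_jlift_tr oO q3 sJ _ ow); last exact: smooth_mulmx.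
  by apply: (mlift_ext oO) ow => u ou; exact: th.
by rewrite mulmxDr mulmxDl -!tensor //; [case: sc|case: sg].
Qed.

Lemma deformed_lift2_pseudo_riemannian : pseudo_riemannian (deformed_lift2 g c).
Proof.
split; last by move=> i w; rewrite T2_chart_image //; exact: deformed_lift2_unit.
have gs i x : chart_image i x -> (g i x)^T = g i x by case: sg => _; apply.
have cs i x : chart_image i x -> (c i x)^T = c i x by case: sc => _; apply.
split; last first.
  move=> i w; rewrite T2_chart_image // => Uw; have oU := open_chart_image mM i.
  rewrite (deformed_lift2E mM) // linearD /= !mlift_tr.
  by congr (_ + _); apply: (mlift_ext oU) Uw => u Uu; [exact: gs|exact: cs].
split=> [i|i j w].
  rewrite T2_chart_image //; have oU := open_chart_image mM i.
  apply: (smooth_ext (open_tube oU) (f := fun w => mlift 2 (g i) w + mlift 0 (c i) w)).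
    by move=> w Uw; rewrite (deformed_lift2E mM).
  by apply: smooth_add; [exact: open_tube|exact: smooth_mlift|exact: smooth_mlift].
by rewrite T2_overlap //; exact: deformed_lift2_transition.
Qed.

End LiftedMetric.

(** * The theorem *)

Section Main.
Context {R : realType} {n : nat} (M : charted R n).
Variables (J g c : mcomp M) (JJ : mcomp (T2 M)).
Hypotheses (akJ : anti_kahler J g) (sc : symmetric_tensor02 c) (lJ : is_lift2_11 J JJ).

Let mM : is_manifold M. Proof. by case: akJ. Qed.

Let mT : is_manifold (T2 M). Proof. exact: T2_manifold. Qed.

Let sJ i : smooth_on (chart_image i) (J i).
Proof. by case: akJ => _ [[sJ _] _] _ _. Qed.

Let sg i : smooth_on (chart_image i) (g i).
Proof. by case: akJ => _ _ [[[[sg _] _] _] _] _. Qed.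

Let scm i : smooth_on (chart_image i) (c i).
Proof. by case: sc => -[]. Qed.

Let Jg i x : chart_image i x -> J i x *m g i x = g i x *m (J i x)^T.
Proof. by case/(anti_kahlerP mM): akJ => _ _ H _; apply: H. Qed.

Let phig i k a b x : chart_image i x -> phi (J i) (g i) k a b x = 0.
Proof. by case/(anti_kahlerP mM): akJ => _ _ _; apply. Qed.

Let JJE (i : idx M) w : tube (chart_image i) w -> JJ i w = jlift (J i) w.
Proof. exact: is_lift2_11E. Qed.

Let gbarE (i : idx M) w : tube (chart_image i) w ->
  deformed_lift2 g c i w = mlift 2 (g i) w + mlift 0 (c i) w.
Proof. exact: deformed_lift2E. Qed.

Let lift_almost_complex : almost_complex JJ.
Proof.
split; first by case: lJ.
move=> i w; rewrite T2_chart_image // => Uw; have oU := open_chart_image mM i.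
rewrite JJE // (jlift_mulmx oU) // (jlift_ext oU (J' := fun=> (-1)%:M)) //; last first.
  by move=> x cx; rewrite raddfN /=; case: akJ => _ [_ H] _ _; exact: H.
by rewrite jlift_cst raddfN.
Qed.

(** The parts coming from [g] agree on both sides, and cancel. *)
Let gbar_pure (i : idx M) w : tube (chart_image i) w ->
  (JJ i w *m deformed_lift2 g c i w = deformed_lift2 g c i w *m (JJ i w)^T) <->
  (mlift 0 (fun x => J i x *m c i x) w = mlift 0 (fun x => c i x *m (J i x)^T) w).
Proof.
move=> Uw; have oU := open_chart_image mM i.
rewrite JJE // gbarE // mulmxDr mulmxDl !(jlift_mlift oU) // !(mlift_jlift_tr oU) //.
rewrite (mlift_ext oU 2 (@Jg i) Uw).
by split=> [/addrI|->].
Qed.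

Let gbar_phi (i : idx M) k a b w : tube (chart_image i) w ->
  phi (JJ i) (deformed_lift2 g c i) k a b w =
  lft (wt k + wt a + wt b) 0 (phi (J i) (c i) (bs k) (bs a) (bs b)) w.
Proof.
move=> Uw; have oU := open_chart_image mM i; have oT := open_tube oU.
rewrite (phi_ext k a b oT (@JJE i) (@gbarE i) Uw).
rewrite phi_add; last 3 first.
- exact: smooth_diff (smooth_jlift oU (@sJ i)) Uw.
- exact: smooth_diff (smooth_mlift oU 2 (@sg i)) Uw.
- exact: smooth_diff (smooth_mlift oU 0 (@scm i)) Uw.
rewrite !(phi_lift oU) // (lft_ext oU _ _ (h := fun=> 0) _ Uw).
  by rewrite lft_cst // if_same add0r.
by move=> x; exact: phig.
Qed.

(** A jet over [x], that of the constant curve. *)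
Let over (x : 'rV[R]_n) : 'rV[R]_(n + n + n) := row_mx (row_mx x 0) 0.

Let xpart_over x : xpart (over x) = x.
Proof. by rewrite /xpart /over !row_mxKl. Qed.

Lemma anti_kahler_lift_holomorphic :
  anti_kahler JJ (deformed_lift2 g c) <-> holomorphic J c.
Proof.
rewrite (anti_kahlerP mT) (holomorphicP mM) //; split=> [[_ _ pJJ phiJJ]|[pJ phiJ]].
  split=> [i x cx|i k a b x cx].
    have Uw : tube (chart_image i) (over x) by rewrite /tube /= xpart_over.
    have /(gbar_pure Uw)/matrixP H : JJ i (over x) *m deformed_lift2 g c i (over x) =
      deformed_lift2 g c i (over x) *m (JJ i (over x))^T.
      by apply: pJJ; rewrite T2_chart_image.
    apply/matrixP => a b; have := H (slot 0 a) (slot 0 b).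
    by rewrite !mlift_slot // /lft /prolong /= xpart_over.
  have Uw : tube (chart_image i) (over x) by rewrite /tube /= xpart_over.
  have := gbar_phi (slot 0 k) (slot 0 a) (slot 0 b) Uw.
  rewrite phiJJ ?T2_chart_image // !wt_slot // !bs_slot //.
  by rewrite /lft /prolong /= xpart_over => ->.
split=> //.
- by apply: deformed_lift2_pseudo_riemannian => //; case: akJ => _ _ [[]].
- move=> i w; rewrite T2_chart_image // => Uw; apply/(gbar_pure Uw).
  by apply: (mlift_ext (open_chart_image mM i)) Uw => x; exact: pJ.
- move=> i k a b w; rewrite T2_chart_image // => Uw; rewrite gbar_phi //.
  rewrite (lft_ext (open_chart_image mM i) _ _ (h := fun=> 0) _ Uw).
    by rewrite lft_cst // if_same.
  by move=> x; exact: phiJ.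
Qed.

End Main.

Theorem theorem3 (R : realType) (n : nat) (M : charted R n)
    (J g c : mcomp M) (JJ : mcomp (T2 M)) :
  (4 <= n)%N ->
  anti_kahler J g ->
  symmetric_tensor02 c ->
  is_lift2_11 J JJ ->
  (anti_kahler JJ (deformed_lift2 g c) <-> holomorphic J c).
Proof. by move=> _; exact: anti_kahler_lift_holomorphic. Qed.
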